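(* Suppose that $k$ is a field of characteristic $0$. Let $\mathcal{G}$ be a multipliability exponential group over $k$ with evaluations, let $n>0$ be an integer, let $g_1,\dots,g_n\in\mathcal{G}$ and let $\lambda_1,\dots,\lambda_n\in k$ with $\lambda_1+\cdots+\lambda_n\neq0$. There is a unique $f\in\mathcal{G}$ with $$g_1f^{\lambda_1}\cdots g_nf^{\lambda_n}=1.$$
   Context: **Exponential groups.** An exponential group (over $k$) is a group $\mathcal{G}$ with a map $k\times\mathcal{G}\to\mathcal{G}$, $(\lambda,f)\mapsto f^\lambda$ such that $f^1=f$, $f^{\lambda+\mu}=f^\lambda f^\mu$, $(f^\lambda)^\mu=f^{\lambda\mu}$, $(fg)^\lambda=f^\lambda g^\lambda$ whenever $fg=gf$, and $(fgf^{-1})^\lambda=fg^\lambda f^{-1}$. Homomorphisms are group homomorphisms commuting with power maps. **Multipliability.** $\mathbf{Los}$ is the class of linearly ordered sets $I=(\underline I,<)$; $I^*$ is $I$ with reversed order; $i^+=\{j\in I: j>i\}$. Write $I=\coprod_J(I_j)_{j}$ if $J\in\mathbf{Los}$, $\underline I=\bigcup_j \underline{I_j}$ and all elements of $I_j$ are $<$ all elements of $I_{j'}$ whenever $j<j'$ in $J$. A multipliability structure on $\mathcal{G}$ is a class of partial maps $\Pi_I:\mathcal{G}^{\underline I}\to\mathcal{G}$ ($I\in\mathbf{Los}$) such that for all $I,J\in\mathbf{Los}$: (MG1) $\operatorname{dom}\Pi_I$ is a subgroup of $\mathcal{G}^{\underline I}$; for $f,g\in\operatorname{dom}\Pi_I$,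 $f[g]:=(\Pi_{(i^+)^*}(f^{-1}\upharpoonright i^+)\cdot g(i)\cdot\Pi_{i^+}(f\upharpoonright i^+))_{i\in I}$ is in $\operatorname{dom}\Pi_I$ and $\Pi_I(f\cdot g)=(\Pi_I f)(\Pi_I f[g])$. (MG2) Every finitely supported $g$ is in $\operatorname{dom}\Pi_I$, and if $\operatorname{supp}g=\{i_1<\dots<i_n\}$, then $\Pi_I g=g(i_1)\cdots g(i_n)$. (MG3) If $\varphi:I\to J$ is an order isomorphism and $g\in\operatorname{dom}\Pi_J$, then $g\circ\varphi\in\operatorname{dom}\Pi_I$ and $\Pi_I(g\circ\varphi)=\Pi_Jg$. (MG4) If $I=\coprod_J(I_j)_j$ and $g\in\operatorname{dom}\Pi_I$, then $g\upharpoonright I_j\in\operatorname{dom}\Pi_{I_j}$ for all $j$, $(\Pi_{I_j}(g\upharpoonright I_j))_j\in\operatorname{dom}\Pi_J$ and $\Pi_J((\Pi_{I_j}(g\upharpoonright I_j))_j)=\Pi_Ig$. (MG5) If $I=I_1\amalg I_2$ and $(g,h)\in\operatorname{dom}\Pi_{I_1}\times\operatorname{dom}\Pi_{I_2}$, then $g\sqcup h\in\operatorname{dom}\Pi_I$. (MG6) If $g\in\operatorname{dom}\Pi_I$ and $g_0\in\mathcal{G}$, then $(g_0g(i)g_0^{-1})_i\in\operatorname{dom}\Pi_I$ with product $g_0(\Pi_Ig)g_0^{-1}$. (MEG7) If $g\in\operatorname{dom}\Pi_I$, then $g^{-1}\in\operatorname{dom}\Pi_{I^*}$ and $\Pi_{I^*}g^{-1}=(\Pi_Ig)^{-1}$.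 (MEG8) If $g\in\operatorname{dom}\Pi_I$ and $f_i:X_i\to k$ ($i\in I$) have finite domains, then $(g(i)^{f_i(x)})_{i\in I,x\in X_i}$ is multipliable (for any linear ordering of the index set). (MEG9) For each linear ordering $\triangleleft$ on $\underline I$, $\operatorname{dom}\Pi_I=\operatorname{dom}\Pi_{(\underline I,\triangleleft)}$. Elements of $\operatorname{dom}\Pi_I$ are called multipliable families. A map $\Phi$ is strongly multiplicative if for $g\in\operatorname{dom}\Pi_I$, $\Phi\circ g$ is multipliable and $\Pi_I(\Phi\circ g)=\Phi(\Pi_Ig)$. **Formal series.** For a set $I$, $k\langle\!\langle I\rangle\!\rangle$ is the algebra of formal power series in non-commuting associative variables $X_i$, $i\in I$: all functions from the free monoid $I^\star$ to $k$, with the Cauchy product; a family $(P_j)_j$ is summable iff each word lies in the support of finitely many $P_j$, with pointwise sum. $k\langle\!\langle I\rangle\!\rangle_0$ is the set of series with zero constant term; $\exp(P)=\sum_n P^n/n!$ and $\log(1+P)=\sum_n\frac{(-1)^n}{n+1}P^{n+1}$ for $P\in k\langle\!\langle I\rangle\!\rangle_0$. $\mathrm{Lie}\langle\!\langle I\rangle\!\rangle$ is the smallest submodule of $k\langle\!\langle I\rangle\!\rangle$ that contains all $X_i$, is closed under $[P,Q]=PQ-QP$, and contains the sum of each of its summable families. **Evaluations.** $1+k\langle\!\langle I\rangle\!\rangle_0$ is an exponential group with $Q^\lambda=\exp(\lambda\log Q)$; $(Q_j)_{j\in J}$ is multipliable iff $(Q_j-1)_j$ is summable, and then $\Pi_J(Q_j)_j=\sum_{j_1<\dots<j_n}(Q_{j_1}-1)\cdots(Q_{j_n}-1)$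 (sum over all finite increasing sequences, including the empty one). $\mathrm{Gr}\langle\!\langle I\rangle\!\rangle:=\exp(\mathrm{Lie}\langle\!\langle I\rangle\!\rangle)$ is an exponential subgroup closed under such products, with the restricted structure. A multipliability exponential group $\mathcal{G}$ (exponential group with a multipliability structure) has evaluations if for every set $I$ and multipliable $f:I\to\mathcal{G}$ there is a strongly multiplicative exponential group homomorphism $\mathrm{ev}^{\mathrm{Gr}}_f:\mathrm{Gr}\langle\!\langle I\rangle\!\rangle\to\mathcal{G}$ with $\exp(X_i)\mapsto f(i)$ for all $i\in I$. *)

(* Defs.v *)
From HB Require Import structures.
From mathcomp Require Import all_boot all_order all_algebra.
From mathcomp Require Import boolp classical_sets functions cardinality fsbigop.

Set Implicit Arguments.
Unset Strict Implicit.
Unset Printing Implicit Defensive.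

Import GRing.Theory.

Local Open Scope classical_set_scope.
Local Open Scope ring_scope.

(* A strict linear order on an arbitrary type.  We do not use [orderType]:
   several orders on one and the same set have to be compared. *)
Record linear_order (T : Type) := LinearOrder {
  lo_lt :> rel T;
  lo_irr : irreflexive lo_lt;
  lo_trans : transitive lo_lt;
  lo_total : forall x y, x <> y -> lo_lt x y || lo_lt y x
}.

Section LinearOrders.
Variables (T : Type) (o : linear_order T).

Fact dual_trans : transitive (fun x y => o y x).
Proof. by move=> y x z oyx ozy; apply: lo_trans ozy oyx. Qed.

Fact dual_total x y : x <> y -> o y x || o x y.
Proof. by rewrite orbC; apply: lo_total. Qed.

Definition dual_order : linear_order T :=
  @LinearOrder T (fun x y => o y x) (lo_irr o) dual_trans dual_total.

Variable A : set T.

Fact sub_irr : irreflexive (fun x y : A => o (\val x) (\val y)).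
Proof. by move=> x; apply: lo_irr. Qed.

Fact sub_trans : transitive (fun x y : A => o (\val x) (\val y)).
Proof. by move=> y x z; apply: lo_trans. Qed.

Fact sub_total (x y : A) :
  x <> y -> o (\val x) (\val y) || o (\val y) (\val x).
Proof. by move=> xy; apply: lo_total => /val_inj. Qed.

Definition sub_order : linear_order A := LinearOrder sub_irr sub_trans sub_total.

Definition above (i : T) : set T := [set j | o i j].

End LinearOrders.

(* I = \coprod_J (I_j)_j, the I_j being subsets of I; empty I_j are allowed. *)
Definition ordered_coproduct (I J : Type) (o : linear_order I)
    (p : linear_order J) (B : J -> set I) : Prop :=
  \bigcup_j B j = setT /\
  forall j j', p j j' -> forall x y, B j x -> B j' y -> o x y.

Definition ordered_coproduct2 (I : Type) (o : linear_order I)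
    (A B : set I) : Prop :=
  A `|` B = setT /\ forall x y, A x -> B y -> o x y.

Definition order_iso (I J : Type) (o : linear_order I) (p : linear_order J)
    (phi : I -> J) : Prop :=
  bijective phi /\ forall x y, o x y = p (phi x) (phi y).

Reserved Notation "f ^^ l" (at level 29, left associativity).

HB.mixin Record Group_isExponential (k : fieldType) G of Group G := {
  powg : G -> k -> G;
  powg1 : forall f : G, powg f 1%R = f;
  powgD : forall (f : G) (l m : k), powg f (l + m)%R = (powg f l * powg f m)%g;
  powgM : forall (f : G) (l m : k), powg (powg f l) m = powg f (l * m)%R;
  powMg : forall (f g : G) (l : k), (f * g = g * f)%g ->
    powg (f * g)%g l = (powg f l * powg g l)%g;
  powJg : forall (f g : G) (l : k),
    powg (f * g * f^-1)%g l = (f * powg g l * f^-1)%g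
}.

#[short(type="expGroupType")]
HB.structure Definition ExpGroup (k : fieldType) :=
  {G of Group_isExponential k G & Group G}.

Notation "f ^^ l" := (powg f l) : group_scope.

(* The partial map Pi_I is given by its domain, [multipliable], and a total
   function, [gprod], whose values are only meaningful on that domain. *)
HB.mixin Record ExpGroup_isMultipliability (k : fieldType) G
    of ExpGroup k G := {
  multipliable : forall T : Type, linear_order T -> (T -> G) -> Prop;
  gprod : forall T : Type, linear_order T -> (T -> G) -> G;
  multipliable1 : forall (I : Type) (o : linear_order I),
    multipliable I o (fun=> 1%g);
  multipliableM : forall (I : Type) (o : linear_order I) (f g : I -> G),
    multipliable I o f -> multipliable I o g ->
    multipliable I o (fun i => f i * g i)%g;
  multipliableV : forall (I : Type) (o : linear_order I) (f : I -> G),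
    multipliable I o f -> multipliable I o (fun i => (f i)^-1)%g;
  gprodM : forall (I : Type) (o : linear_order I) (f g : I -> G),
    multipliable I o f -> multipliable I o g ->
    let fg i :=
      (gprod (above o i) (dual_order (sub_order o (above o i)))
         (sigL (above o i) (fun j => (f j)^-1))
       * g i
       * gprod (above o i) (sub_order o (above o i))
         (sigL (above o i) f))%g in
    multipliable I o fg /\
    gprod I o (fun i => f i * g i)%g = (gprod I o f * gprod I o fg)%g;
  multipliable_fin : forall (I : Type) (o : linear_order I) (g : I -> G),
    finite_set [set i | g i <> 1%g] -> multipliable I o g;
  gprod_fin : forall (I : Type) (o : linear_order I) (g : I -> G)
      (n : nat) (i : 'I_n -> I),
    (forall a b : 'I_n, (a < b)%N -> o (i a) (i b)) ->
    [set j | g j <> 1%g] = range i ->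
    gprod I o g = (\prod_(a < n) g (i a))%g;
  gprod_iso : forall (I J : Type) (o : linear_order I) (p : linear_order J)
      (phi : I -> J) (g : J -> G),
    order_iso o p phi -> multipliable J p g ->
    multipliable I o (g \o phi) /\ gprod I o (g \o phi) = gprod J p g;
  gprod_coproduct : forall (I J : Type) (o : linear_order I)
      (p : linear_order J) (B : J -> set I) (g : I -> G),
    ordered_coproduct o p B -> multipliable I o g ->
    let gB j := gprod (B j) (sub_order o (B j)) (sigL (B j) g) in
    [/\ forall j, multipliable (B j) (sub_order o (B j)) (sigL (B j) g),
        multipliable J p gB & gprod J p gB = gprod I o g];
  (* A pair (g, h) of families on A and B is the same thing as a
     family on I, namely its union *)
  multipliable_coproduct2 : forall (I : Type) (o : linear_order I)
      (A B : set I) (g : I -> G),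
    ordered_coproduct2 o A B ->
    multipliable A (sub_order o A) (sigL A g) ->
    multipliable B (sub_order o B) (sigL B g) ->
    multipliable I o g;
  gprodJ : forall (I : Type) (o : linear_order I) (g : I -> G) (g0 : G),
    multipliable I o g ->
    multipliable I o (fun i => g0 * g i * g0^-1)%g /\
    gprod I o (fun i => g0 * g i * g0^-1)%g = (g0 * gprod I o g * g0^-1)%g;
  gprodV : forall (I : Type) (o : linear_order I) (g : I -> G),
    multipliable I o g ->
    multipliable I (dual_order o) (fun i => (g i)^-1)%g /\
    gprod I (dual_order o) (fun i => (g i)^-1)%g = ((gprod I o g)^-1)%g;
  multipliable_pow : forall (I : Type) (o : linear_order I) (g : I -> G)
      (X : I -> Type) (f : forall i, X i -> k),
    multipliable I o g -> (forall i, finite_set [set: X i]) ->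
    forall p : linear_order {i : I & X i},
      multipliable {i : I & X i} p
        (fun ix => (g (projT1 ix) ^^ f (projT1 ix) (projT2 ix))%g);
  multipliable_order : forall (I : Type) (o p : linear_order I) (g : I -> G),
    multipliable I o g <-> multipliable I p g
}.

#[short(type="multExpGroupType")]
HB.structure Definition MultExpGroup (k : fieldType) :=
  {G of ExpGroup_isMultipliability k G & ExpGroup k G}.

Arguments multipliable {k s T} o g.
Arguments gprod {k s T} o g.

(* Formal power series in non-commuting variables indexed by I; words are
   elements of [seq I]. *)
Definition series (k : fieldType) (I : Type) := seq I -> k.

Section Series.
Variables (k : fieldType) (I : Type).
Implicit Types (P Q : series k I) (w : seq I).

HB.instance Definition _ := GRing.Lmodule.copy (series k I) (seq I -> k^o).

Fact seriesDE P Q w : (P + Q) w = P w + Q w. Proof. by []. Qed.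

Fact seriesZE (a : k) P w : (a *: P) w = a * P w. Proof. by []. Qed.

Definition series_one : series k I := fun w => (nilp w)%:R.

Definition series_mul P Q : series k I :=
  fun w => \sum_(j < (size w).+1) P (take j w) * Q (drop j w).

Definition series_shift (x : I) P : series k I := fun w => P (x :: w).

Fact series_mul_nil P Q : series_mul P Q [::] = P [::] * Q [::].
Proof. by rewrite /series_mul big_ord1. Qed.

Fact series_mul_cons P Q x w :
  series_mul P Q (x :: w) = P [::] * Q (x :: w) + series_mul (series_shift x P) Q w.
Proof. by rewrite /series_mul big_ord_recl. Qed.

Fact series_mulDl : left_distributive series_mul +%R.
Proof.
move=> P Q R; apply/funext => w; rewrite seriesDE /series_mul -big_split /=.
by apply: eq_bigr => j _; rewrite -mulrDl.
Qed.

Fact series_mulDr : right_distributive series_mul +%R.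
Proof.
move=> P Q R; apply/funext => w; rewrite seriesDE /series_mul -big_split /=.
by apply: eq_bigr => j _; rewrite -mulrDr.
Qed.

Fact series_scaleAl (a : k) P Q :
  a *: series_mul P Q = series_mul (a *: P) Q.
Proof.
apply/funext => w; rewrite seriesZE /series_mul mulr_sumr.
by apply: eq_bigr => j _; rewrite mulrA.
Qed.

Fact series_scaleAr (a : k) P Q :
  a *: series_mul P Q = series_mul P (a *: Q).
Proof.
apply/funext => w; rewrite seriesZE /series_mul mulr_sumr.
by apply: eq_bigr => j _; rewrite mulrCA.
Qed.

Fact series_mulA : associative series_mul.
Proof.
move=> P Q R; apply/funext => w; elim: w => [|x w IHw] in P Q R *.
  by rewrite !series_mul_nil mulrA.
rewrite !series_mul_cons series_mul_nil IHw.
have -> : series_shift x (series_mul P Q) =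
    P [::] *: series_shift x Q + series_mul (series_shift x P) Q.
  by apply/funext => v; rewrite /series_shift series_mul_cons.
rewrite series_mulDl -series_scaleAl seriesDE seriesZE.
by rewrite mulrDr mulrA addrA.
Qed.

Fact series_mul1l : left_id series_one series_mul.
Proof.
move=> P; apply/funext => w; rewrite /series_mul big_ord_recl take0 drop0.
rewrite mul1r big1 ?addr0 // => j _.
by case: w j => [[]//|x w j]; rewrite /series_one /= mul0r.
Qed.

Fact series_mul1r : right_id series_one series_mul.
Proof.
move=> P; apply/funext => w; rewrite /series_mul big_ord_recr /= take_size drop_size.
rewrite mulr1 big1 ?add0r // => j _.
by rewrite /series_one /nilp size_drop subn_eq0 leqNgt ltn_ord mulr0.
Qed.

Fact series_one_neq0 : series_one != 0.
Proof.
by apply/eqP => /(congr1 (@^~ [::])) /eqP; rewrite oner_eq0.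
Qed.

HB.instance Definition _ := GRing.Zmodule_isNzRing.Build (series k I)
  series_mulA series_mul1l series_mul1r series_mulDl series_mulDr series_one_neq0.

HB.instance Definition _ :=
  GRing.Lmodule_isLalgebra.Build k (series k I) series_scaleAl.

HB.instance Definition _ :=
  GRing.Lalgebra_isAlgebra.Build k (series k I) series_scaleAr.

Definition series_var (i : I) : series k I := fun w => `[< w = [:: i] >]%:R.

Definition summable (J : Type) (A : set J) (P : J -> series k I) : Prop :=
  forall w, finite_set [set j | A j /\ P j w <> 0].

(* Meaningful only when [P] is summable on [A]: the pointwise sum is then a
   sum of finitely many nonzero terms. *)
Definition series_sum (J : Type) (A : set J) (P : J -> series k I) :
    series k I :=
  fun w => \sum_(j \in (A : set {classic J})) P j w.

Definition series_exp P : series k I :=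
  series_sum [set: nat] (fun n => (n`!)%:R^-1 *: P ^+ n).

Definition series_log Q : series k I :=
  series_sum [set: nat] (fun n => ((-1) ^+ n / n.+1%:R) *: (Q - 1) ^+ n.+1).

Definition lie_closed (S : set (series k I)) : Prop :=
  [/\ S 0,
      forall (a : k) P Q, S P -> S Q -> S (a *: P + Q),
      forall P Q, S P -> S Q -> S (P * Q - Q * P) &
      forall (J : Type) (P : J -> series k I), summable [set: J] P ->
        (forall j, S (P j)) -> S (series_sum [set: J] P)].

Definition Lie : set (series k I) := smallest lie_closed (range series_var).

Definition Gr : set (series k I) := series_exp @` Lie.

Definition series_pow Q (l : k) : series k I :=
  series_exp (l *: series_log Q).

Definition series_multipliable (J : Type) (Q : J -> series k I) : Prop :=
  summable [set: J] (fun j => Q j - 1).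

Definition series_prod (J : Type) (p : linear_order J)
    (Q : J -> series k I) : series k I :=
  series_sum [set s : seq J | sorted p s]
    (fun s => \prod_(j <- s) (Q j - 1)).

End Series.

Arguments series_var {k I} i.
Arguments Lie k I : clear implicits.
Arguments Gr k I : clear implicits.

(* A map on [Gr k I] is encoded as a map on all series, constrained only on
   [Gr k I], which in characteristic 0 is a group under *%R and is closed under
   [series_pow] and under [series_prod] of multipliable families. *)
Definition gr_morphism (k : fieldType) (I : Type) (G : multExpGroupType k)
    (ev : series k I -> G) : Prop :=
  (forall P Q, Gr k I P -> Gr k I Q -> ev (P * Q) = (ev P * ev Q)%g) /\
  (forall P (l : k), Gr k I P -> ev (series_pow P l) = (ev P ^^ l)%g).

Definition gr_strongly_multiplicative (k : fieldType) (I : Type)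
    (G : multExpGroupType k) (ev : series k I -> G) : Prop :=
  forall (J : Type) (p : linear_order J) (Q : J -> series k I),
    (forall j, Gr k I (Q j)) -> series_multipliable Q ->
    multipliable p (ev \o Q) /\ gprod p (ev \o Q) = ev (series_prod p Q).

(* By [multipliable_order] the choice of [o] is immaterial, so that this
   quantifies over the multipliable families indexed by a bare set. *)
Definition has_evaluations (k : fieldType) (G : multExpGroupType k) : Prop :=
  forall (I : Type) (o : linear_order I) (f : I -> G), multipliable o f ->
    exists ev : series k I -> G,
      [/\ gr_morphism ev, gr_strongly_multiplicative ev &
          forall i, ev (series_exp (series_var i)) = f i].

(* Main.v *)
(** Both halves take place in the group [Gr] of exponentials of Lie series.
    That [Gr] is a group (Baker-Campbell-Hausdorff) follows from the derivation
    [euler], which multiplies a word by its length: a series [g] with constant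
    term 1 is the exponential of a Lie series if and only if
    [euler g * g^-1] is a Lie series, and this condition is multiplicative.

    Existence: write [L] for the sum of the [l i] and put [f = exp Y].  The map
    [Y |-> Y - L^-1 log (prod_i (exp X_i * exp (l_i Y)))] preserves Lie series and
    gains one degree of precision at each application, so that it has a fixed
    point; evaluate it at the [g i].

    Uniqueness: let [f] and [f * h] be solutions and evaluate [X_i], [Y], [Z] at
    [g i], [f], [h].  The quotient of the two instances of the equation is an
    element [r] of the kernel of the evaluation that is trivial modulo [Z] and
    has linear part [L Z].  Powers and iterated commutators of [r] with
    exponentials provide kernel elements with any prescribed homogeneous leading
    term in the Lie ideal generated by [Z].  Hence [exp Z] is an infinite product
    of kernel elements, and [h = 1] because evaluations are strongly
    multiplicative. *)

Require Import Defs.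
From mathcomp Require Import all_boot all_order all_algebra.
From mathcomp Require Import boolp classical_sets functions cardinality fsbigop.

Set Implicit Arguments.
Unset Strict Implicit.
Unset Printing Implicit Defensive.

Import GRing.Theory.

Local Open Scope classical_set_scope.
Local Open Scope ring_scope.

(** * Order of a series *)

Section Order.
Variables (k : fieldType) (I : Type).
Implicit Types (P Q R : series k I) (w : seq I) (m n : nat).

(** The degree filtration. Congruence modulo degree [m] is written [ord m (P - Q)], and limits of
    series are taken in this sense. *)
Definition ord m P := forall w, (size w < m)%N -> P w = 0.

Lemma ord_le m n P : (m <= n)%N -> ord n P -> ord m P.
Proof. by move=> mn oP w wm; apply/oP/(leq_trans wm). Qed.

Lemma ord_all P : ord 0 P. Proof. by []. Qed.

Lemma ord_0 m : ord m 0. Proof. by []. Qed.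

Lemma ordD m P Q : ord m P -> ord m Q -> ord m (P + Q).
Proof. by move=> oP oQ w wm; rewrite seriesDE oP // oQ // addr0. Qed.

Lemma ordZ m (a : k) P : ord m P -> ord m (a *: P).
Proof. by move=> oP w wm; rewrite seriesZE oP // mulr0. Qed.

Lemma ordN m P : ord m P -> ord m (- P).
Proof. by rewrite -scaleN1r; apply: ordZ. Qed.

Lemma ordB m P Q : ord m P -> ord m Q -> ord m (P - Q).
Proof. by move=> oP oQ; apply/ordD/ordN. Qed.

Lemma ord_sum m (J : Type) (r : seq J) (p : pred J) (F : J -> series k I) :
  (forall j, p j -> ord m (F j)) -> ord m (\sum_(j <- r | p j) F j).
Proof. by move=> oF; apply: big_ind => //; apply: ordD. Qed.

Lemma seriesME P Q w :
  (P * Q) w = \sum_(j < (size w).+1) P (take j w) * Q (drop j w).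
Proof. by []. Qed.

Lemma ordM m n P Q : ord m P -> ord n Q -> ord (m + n) (P * Q).
Proof.
move=> oP oQ w wmn; rewrite seriesME big1 // => j _.
have [jm|mj] := ltnP j m.
  rewrite oP ?mul0r // size_take; case: ifP => // /negbT.
  by rewrite -leqNgt => /leq_ltn_trans->.
rewrite oQ ?mulr0 // size_drop ltn_subLR; last by rewrite -ltnS.
by rewrite (leq_trans wmn) // leq_add2r.
Qed.

Lemma ordMr m P Q : ord m P -> ord m (P * Q).
Proof. by move/ordM/(_ (@ord_all Q)); rewrite addn0. Qed.

Lemma ordMl m P Q : ord m Q -> ord m (P * Q).
Proof. exact: (ordM (@ord_all P)). Qed.

Lemma ordX m n P : ord m P -> ord (m * n) (P ^+ n).
Proof.
move=> oP; elim: n => [|n IH]; first by rewrite muln0.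
by rewrite exprS mulnS; apply: ordM.
Qed.

Lemma ord1X n P : ord 1 P -> ord n (P ^+ n).
Proof. by move/(@ordX 1 n); rewrite mul1n. Qed.

Lemma ord_sep P Q : (forall m, ord m (P - Q)) -> P = Q.
Proof.
move=> oPQ; apply/funext => w; apply/eqP.
by rewrite -subr_eq0; apply/eqP/(oPQ (size w).+1).
Qed.

Lemma ord_trans m P Q R : ord m (P - Q) -> ord m (Q - R) -> ord m (P - R).
Proof. by move=> PQ QR; rewrite -(subrKA Q); apply: ordD. Qed.

Lemma ord_sym m P Q : ord m (P - Q) -> ord m (Q - P).
Proof. by move=> PQ; rewrite -opprB; apply: ordN. Qed.

Lemma ord_congr m P Q : ord m (P - Q) -> ord m Q -> ord m P.
Proof. by move=> PQ oQ; rewrite -(subrK Q P); apply: ordD. Qed.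

Lemma ord1E P : ord 1 P <-> P [::] = 0.
Proof.
split=> [oP|P0 w]; first exact: oP.
by case: w.
Qed.

Lemma seriesNE P w : (- P) w = - P w. Proof. by []. Qed.

Lemma sumE (J : Type) (r : seq J) (p : pred J) (F : J -> series k I) w :
  (\sum_(j <- r | p j) F j) w = \sum_(j <- r | p j) F j w.
Proof. exact: (big_morph (fun P : series k I => P w)). Qed.

(* The sum of all [V j], provided that [V j] has order at least [j]: the terms
   left out of the value at [w] then vanish at [w]. *)
Definition osum (V : nat -> series k I) : series k I :=
  fun w => \sum_(j < (size w).+1) V j w.

Lemma ord_osum V N : (forall j, ord j (V j)) ->
  ord N (osum V - \sum_(j < N) V j).
Proof.
move=> oV w wN; rewrite seriesDE seriesNE sumE /osum.
rewrite -!(big_mkord xpredT (fun j => V j w)) (big_cat_nat (leq0n _) wN) /=.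
rewrite opprD addrA subrr sub0r; apply/eqP; rewrite oppr_eq0; apply/eqP.
by rewrite big_nat_cond big1 // => j /andP[/andP[wj _] _]; apply: oV.
Qed.

Lemma osum_ord V m : (forall j, ord m (V j)) -> ord m (osum V).
Proof. by move=> oV w wm; rewrite /osum big1 // => j _; apply: oV. Qed.

Lemma osum_unique V P : (forall j, ord j (V j)) ->
  (forall N, ord N (P - \sum_(j < N) V j)) -> P = osum V.
Proof.
move=> oV oP; apply: ord_sep => m.
by apply: ord_trans (oP m) _; apply/ord_sym/ord_osum.
Qed.

Lemma ord_conv (V W : nat -> series k I) n : (forall j, ord j (V j)) ->
  (forall j, ord j (W j)) -> ord n (\sum_(i < n.+1) V i * W (n - i)%N).
Proof.
move=> oV oW; apply: ord_sum => i _.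
by rewrite -{1}(subnKC (leq_ord i)); apply: ordM.
Qed.

(** Truncations at [N] are values at 1 of polynomials whose coefficients are series, so that the
    Cauchy product comes from the product of polynomials. *)
Lemma osumM (V W : nat -> series k I) : (forall j, ord j (V j)) ->
  (forall j, ord j (W j)) ->
  osum V * osum W = osum (fun n => \sum_(i < n.+1) V i * W (n - i)%N).
Proof.
move=> oV oW; apply: osum_unique => [n|N]; first exact: ord_conv.
pose p := \poly_(j < N) V j; pose q := \poly_(j < N) W j.
have hp (F : nat -> series k I) : (\poly_(j < N) F j).[1] = \sum_(j < N) F j.
  by rewrite horner_poly; apply: eq_bigr => j _; rewrite expr1n mulr1.
have hpq : (p * q).[1] = (\sum_(j < N) V j) * (\sum_(j < N) W j).
  by rewrite hornerM_comm ?hp // /comm_poly mulr1 mul1r.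
apply: (@ord_trans _ _ ((p * q).[1])).
  rewrite hpq -[X in ord _ X](subrKA (osum V * \sum_(j < N) W j)).
  rewrite -mulrBr -mulrBl; apply: ordD.
    by apply/ordMl/ord_osum.
  by apply/ordMr/ord_osum.
(* Coefficients of [p * q] below degree [N] are exact convolutions; those from [N] on have order at
   least [N]. *)
rewrite (@horner_coef_wide _ (N + (size (p * q)%R))) ?leq_addl //.
rewrite big_split_ord /=.
rewrite addrAC -sumrB; apply: ordD; apply: ord_sum => i _.
  rewrite expr1n mulr1 coefM -sumrB; apply: ord_sum => j _.
  by rewrite !coef_poly !(leq_ltn_trans _ (ltn_ord i)) ?leq_subr ?leq_ord// subrr.
rewrite expr1n mulr1 coefM; apply: ord_sum => j _.
apply: (@ord_le _ (N + i)); first exact: leq_addr.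
rewrite -{1}(subnKC (leq_ord j)); apply: ordM.
  by rewrite coef_poly; case: ifP.
by rewrite coef_poly; case: ifP.
Qed.

Lemma fsum_seq (J : Type) (A : set J) (r : seq {classic J}) (F : J -> k) :
  uniq r -> (forall j, j \in r -> A j) ->
  (forall j, A j -> j \notin r -> F j = 0) ->
  \sum_(j \in (A : set {classic J})) F j = \sum_(j <- r) F j.
Proof.
move=> ur rA F0; rewrite (fsbigE r) // [RHS]big_seq [LHS]big_seq_cond.
by apply: eq_bigl => j; case: (boolP (j \in r)) => //= /rA /mem_set.
Qed.

(** [series_sum] sums over [{classic J}], whose equality test is not that of [J]; this and
    [uniq_classic] identify the two on lists. *)
Lemma mem_classic (T : eqType) (x : T) (r : seq T) :
  ((x : {classic T}) \in (r : seq {classic T})) = (x \in r).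
Proof.
elim: r => // y r IH; rewrite !inE IH; congr orb.
by apply/eqP/eqP.
Qed.

Lemma uniq_classic (T : eqType) (r : seq T) :
  uniq (r : seq {classic T}) = uniq r.
Proof. by elim: r => //= x r ->; rewrite mem_classic. Qed.

Lemma series_sum_nat (V : nat -> series k I) : (forall j, ord j (V j)) ->
  series_sum setT V = osum V.
Proof.
move=> oV; apply/funext => w; rewrite /series_sum /osum.
rewrite (@fsum_seq _ _ (iota 0 (size w).+1)) //.
- by rewrite -(big_mkord xpredT (fun j => V j w)) /index_iota subn0.
- by rewrite uniq_classic iota_uniq.
by move=> j _; rewrite mem_classic mem_iota /= add0n -leqNgt => /oV; apply.
Qed.

End Order.

(** * Exponential and logarithm *)

Section PowerSeries.
Variables (k : fieldType) (I : Type).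
Implicit Types (P Q R : series k I) (w : seq I) (m n : nat) (a : nat -> k).

(** Substitution of [P], without constant term, in the one-variable power series with coefficients
    [a]. *)
Definition psum a P : series k I := osum (fun n => a n *: P ^+ n).

Lemma ord_term a P n : ord 1 P -> ord n (a n *: P ^+ n).
Proof. by move=> oP; apply/ordZ/ord1X. Qed.

Lemma ord_subX P Q m n : ord 1 P -> ord 1 Q -> ord m (Q - P) ->
  ord (m + n) (Q ^+ n.+1 - P ^+ n.+1).
Proof.
move=> oP oQ oQP; elim: n => [|n IH]; first by rewrite addn0 !expr1.
rewrite (exprS Q) (exprS P) -(subrKA (Q * P ^+ n.+1)) -mulrBr -mulrBl.
apply: ordD; first by rewrite addnS -add1n; apply: ordM.
exact/ordM/ord1X.
Qed.

(** To first order only the linear coefficient counts: a difference of higher powers carries an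
    extra factor of order 1. The estimates for exponential, logarithm, powers and [newton] derive
    from this. *)
Lemma psum_sub a P Q m : ord 1 P -> ord 1 Q -> ord m (Q - P) ->
  ord m.+1 (psum a Q - psum a P - a 1%N *: (Q - P)).
Proof.
move=> oP oQ oQP.
pose V n := if n is 1 then 0 else a n *: (Q ^+ n - P ^+ n).
have -> : psum a Q - psum a P - a 1%N *: (Q - P) = osum V.
  apply/funext => w; rewrite !(seriesDE, seriesNE) seriesZE seriesDE seriesNE.
  rewrite /psum /osum -sumrB; case: w => [|x w].
    have -> : P [::] = 0 by apply: oP.
    have -> : Q [::] = 0 by apply: oQ.
    by rewrite !big_ord1 /= !expr0 !subrr mulr0 subr0 scaler0.
  rewrite !(big_ord_recl (size w).+1) /= !big_ord_recl /=.
  rewrite !expr0 !subrr scaler0 !add0r !expr1 !seriesZE.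
  rewrite mulrBr addrAC subrr !add0r; apply: eq_bigr => i _.
  by rewrite !seriesZE seriesDE seriesNE mulrBr.
apply: osum_ord => [[|[|n]]] //=; apply: ordZ; first by rewrite !expr0 subrr.
apply: (@ord_le _ _ _ (m + n.+1)); first by rewrite addnS ltnS leq_addr.
exact: ord_subX.
Qed.

Lemma psum_cont a P Q m : ord 1 P -> ord 1 Q -> ord m (Q - P) ->
  ord m (psum a Q - psum a P).
Proof.
move=> oP oQ oQP; apply: ord_congr (ordZ (a 1%N) oQP).
exact/(ord_le (leqnSn m))/psum_sub.
Qed.

Lemma psumM a b P : ord 1 P ->
  psum a P * psum b P = psum (fun n => \sum_(i < n.+1) a i * b (n - i)%N) P.
Proof.
move=> oP; rewrite /psum.
rewrite (osumM (fun j => @ord_term a P j oP) (fun j => @ord_term b P j oP)).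
congr osum; apply/funext => n; rewrite scaler_suml; apply: eq_bigr => i _.
by rewrite -scalerAl -scalerAr scalerA -exprD subnKC // leq_ord.
Qed.

Lemma psum_poly a P N : ord 1 P ->
  ord N (psum a P - horner_alg P (\poly_(i < N) a i)).
Proof.
move=> oP; rewrite poly_def linear_sum /=.
under eq_bigr do rewrite linearZ /= rmorphXn /= horner_algX mulr_algl.
exact: (@ord_osum _ _ (fun j => a j *: P ^+ j) N (fun j => @ord_term a P j oP)).
Qed.

End PowerSeries.

Section FormalExpLog.
Variable k : fieldType.
Hypothesis char0 : [pchar k] =i pred0.

Definition exp_coef n : k := (n`!)%:R^-1.
Definition log_coef n : k := if n is m.+1 then (-1) ^+ m / m.+1%:R else 0.

Lemma natS_neq0 n : n.+1%:R != 0 :> k.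
Proof. by have/pcharf0P -> := char0. Qed.

Lemma fact_neq0 n : n`!%:R != 0 :> k.
Proof. by rewrite -(prednK (fact_gt0 n)) natS_neq0. Qed.

(** Truncated form of log(exp X) = X. The composite has constant term 0 and derivative 1 modulo
    ['X^M], which in characteristic 0 determines its coefficients up to degree [M]. *)
Lemma log_exp_poly M : exists q : {poly k},
  (\poly_(i < M.+1) log_coef i) \Po (\poly_(i < M.+1) exp_coef i - 1) =
  'X + q * 'X^(M.+1).
Proof.
pose e := \poly_(i < M.+1) exp_coef i; pose l := \poly_(i < M.+1) log_coef i.
rewrite -/e -/l; pose p := l \Po (e - 1); rewrite -/p.
have e' : e^`() = 1 + (e - 1) - (exp_coef M)%:P * 'X^M.
  apply/polyP => i; rewrite subrKC coef_deriv coefB coefCM coefXn !coef_poly.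
  rewrite ltnS; case: ltngtP => iM; last 2 first.
  - by rewrite mul0rn ltnS leqNgt iM mulr0 subr0.
  - by rewrite -iM ltnSn mulr1 subrr mul0rn.
  rewrite ltnS (ltnW iM) mulr0 subr0 -[LHS]mulr_natr /exp_coef factS natrM invfM.
  by rewrite mulrAC mulVf ?mul1r ?natS_neq0.
have l' : (1 + 'X) * l^`() = 1 - (- 'X) ^+ M.
  have -> : l^`() = \sum_(i < M) (- 'X) ^+ i.
    apply/polyP => i; rewrite coef_deriv coef_poly ltnS.
    have XE j : (- 'X) ^+ j = ((-1) ^+ j : k) *: 'X^j.
      by rewrite [LHS]exprNn -[RHS]mul_polyC polyC_exp polyCN.
    under eq_bigr do rewrite XE.
    rewrite -poly_def coef_poly; case: ifP => // _; last by rewrite mul0rn.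
    by rewrite -[LHS]mulr_natr mulfVK ?natS_neq0.
  have := subrX1 (- 'X : {poly k}) M; rewrite -opprD -(opprB 1) [_ + 1]addrC.
  by rewrite mulNr => /oppr_inj <-.
(* Divisibility of [e - 1] by ['X] makes the error [(- 'X) ^+ M] a multiple of ['X^M] after
   composition. *)
have e1 : exists u, e - 1 = u * 'X.
  exists (drop_poly 1 (e - 1)); rewrite -{1}(poly_take_drop 1 (e - 1)) expr1.
  suff -> : take_poly 1 (e - 1) = 0 by rewrite add0r.
  apply/polyP => i; rewrite coef_take_poly coef0; case: i => [|//].
  by rewrite coefB coef_poly coef1 /exp_coef fact0 invr1 subrr.
case: e1 => u eu.
have [v p'] : exists v, p^`() = 1 + v * 'X^M.
  have -> : p^`() = ((1 + 'X) * l^`()) \Po (e - 1)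
      - (l^`() \Po (e - 1)) * (exp_coef M)%:P * 'X^M.
    rewrite /p deriv_comp derivB derivC subr0 e' comp_polyM comp_polyD.
    by rewrite comp_polyC comp_polyX mulrBr mulrA [X in X - _]mulrC.
  exists (- (- u) ^+ M - (l^`() \Po (e - 1)) * (exp_coef M)%:P).
  rewrite l' comp_polyB comp_polyC rmorphXn /= raddfN /= comp_polyX eu.
  by rewrite -mulNr exprMn mulrBl mulNr addrA.
exists (drop_poly M.+1 (p - 'X)); rewrite -{1}(subrKC 'X p); congr (_ + _).
rewrite -{1}(poly_take_drop M.+1 (p - 'X)).
suff -> : take_poly M.+1 (p - 'X) = 0 by rewrite add0r.
apply/polyP => i; rewrite coef_take_poly coef0; case: ltnP => // iM.
rewrite coefB coefX; case: i iM => [_|i iM].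
  rewrite subr0 -horner_coef0 horner_comp !hornerE horner_coef0 coef_poly /=.
  by rewrite /exp_coef fact0 invr1 subrr horner_coef0 coef_poly.
have /(congr1 (fun r : {poly k} => r`_i)) := p'.
rewrite coef_deriv coefD coefMXn coef1 -ltnS iM addr0 -[LHS]mulr_natr => p'i.
apply/eqP; rewrite subr_eq0; apply/eqP/(mulIf (natS_neq0 i)); rewrite p'i.
by case: i {p'i iM} => [|i]; rewrite ?mulr1 ?mul0r.
Qed.

Lemma exp_coef_conv (a b : k) n :
  \sum_(i < n.+1) (exp_coef i * a ^+ i) * (exp_coef (n - i) * b ^+ (n - i)) =
  exp_coef n * (a + b) ^+ n.
Proof.
rewrite addrC exprDn mulr_sumr; apply: eq_bigr => i _.
rewrite -[_ *+ 'C(n, i)]mulr_natl [b ^+ _ * _]mulrC [RHS]mulrA mulrACA.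
congr (_ * _).
apply: (mulfI (fact_neq0 n)); rewrite /exp_coef mulVKf ?fact_neq0 //.
rewrite -(bin_fact (leq_ord i)) !natrM -invfM mulfK //.
by rewrite mulf_neq0 // fact_neq0.
Qed.

End FormalExpLog.

Section ExpLog.
Variables (k : fieldType) (I : Type).
Hypothesis char0 : [pchar k] =i pred0.
Implicit Types (P Q R g h : series k I) (w : seq I) (m n : nat).

Lemma horner_alg_comp P (p q : {poly k}) :
  horner_alg (horner_alg P q) p = horner_alg P (p \Po q).
Proof.
elim/poly_ind: p => [|p c IH]; first by rewrite comp_poly0 !rmorph0.
rewrite comp_polyD comp_polyM comp_polyX comp_polyC !rmorphD !rmorphM /=.
by rewrite IH horner_algX !horner_algC.
Qed.

Lemma series_expE P : ord 1 P -> series_exp P = psum (exp_coef k) P.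
Proof. by move=> oP; apply: series_sum_nat => n; apply/ordZ/ord1X. Qed.

Lemma series_logE g : ord 1 (g - 1) -> series_log g = psum (log_coef k) (g - 1).
Proof.
move=> og; rewrite /series_log series_sum_nat; last first.
  by move=> j; apply/(ord_le (leqnSn j))/ordZ/ord1X.
(* The two indexings differ by one: the last power on the left exceeds the length of [w], and the
   first coefficient on the right is 0. *)
apply/funext => w; rewrite /psum /osum big_ord_recr big_ord_recl /=.
rewrite scale0r add0r.
have oX : ord (size w).+1 ((g - 1) ^+ (size w).+1) by apply: ord1X.
by rewrite seriesZE oX // mulr0 addr0.
Qed.

Lemma series_exp_nil P : ord 1 P -> series_exp P [::] = 1.
Proof.
move=> oP; rewrite series_expE // /psum /osum big_ord1 seriesZE.
by rewrite /exp_coef fact0 invr1 mul1r.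
Qed.

Lemma ord1_exp P : ord 1 P -> ord 1 (series_exp P - 1).
Proof.
move=> oP; apply/ord1E; rewrite seriesDE seriesNE series_exp_nil //.
by rewrite subrr.
Qed.

Lemma ord1_log g : ord 1 (g - 1) -> ord 1 (series_log g).
Proof.
move=> og; apply/ord1E; rewrite series_logE // /psum /osum big_ord1 seriesZE.
by rewrite mul0r.
Qed.

Lemma exp_sub P Q m : ord 1 P -> ord 1 Q -> ord m (Q - P) ->
  ord m.+1 (series_exp Q - series_exp P - (Q - P)).
Proof.
move=> oP oQ oQP; rewrite !series_expE //.
have := @psum_sub _ _ (exp_coef k) _ _ _ oP oQ oQP.
by rewrite /exp_coef invr1 scale1r.
Qed.

Lemma log_sub g h m : ord 1 (g - 1) -> ord 1 (h - 1) -> ord m (h - g) ->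
  ord m.+1 (series_log h - series_log g - (h - g)).
Proof.
move=> og oh ohg; rewrite !series_logE //.
have e : (h - 1) - (g - 1) = h - g by rewrite opprB addrA subrK.
have := @psum_sub _ _ (log_coef k) (g - 1) (h - 1) m og oh.
by rewrite e /log_coef expr0 divr1 scale1r; apply.
Qed.

(** Modulo degree [m.+1] both power series are replaced by their truncations; the error in
    [log_exp_poly] becomes a multiple of [P ^+ m.+1]. *)
Lemma expK P : ord 1 P -> series_log (series_exp P) = P.
Proof.
move=> oP; have oE := ord1_exp oP; rewrite series_logE //.
apply: ord_sep => m; apply: (ord_le (leqnSn m)).
have [q eq_q] := log_exp_poly char0 m.
pose e : {poly k} := \poly_(i < m.+1) exp_coef k i.
pose l : {poly k} := \poly_(i < m.+1) log_coef k i.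
have eE : ord m.+1 (series_exp P - 1 - horner_alg P (e - 1)).
  rewrite rmorphB rmorph1 opprB addrA subrK series_expE //.
  exact: psum_poly.
have oe : ord 1 (horner_alg P (e - 1)).
  by apply: ord_congr oE; apply/ord_sym/(ord_le _ eE).
apply: ord_trans (psum_cont _ oe oE eE) _.
apply: ord_trans (psum_poly _ oe) _.
rewrite horner_alg_comp eq_q rmorphD rmorphM /= rmorphXn /= horner_algX.
rewrite addrAC subrr add0r.
by rewrite -[m.+1]add0n; apply/ordM/ord1X.
Qed.

(** By [expK] both sides have the same logarithm, and by [log_sub] the logarithm preserves the
    leading term of a difference; so agreement modulo degree [m] improves to [m.+1]. *)
Lemma logK g : ord 1 (g - 1) -> series_exp (series_log g) = g.
Proof.
move=> og; have ol := ord1_log og; have oe := ord1_exp ol.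
apply: ord_sep; elim=> // m IH.
have := log_sub og oe IH; rewrite expK // subrr add0r.
by move/ordN; rewrite opprK.
Qed.

Lemma expD (a b : k) P : ord 1 P ->
  series_exp (a *: P) * series_exp (b *: P) = series_exp ((a + b) *: P).
Proof.
move=> oP; rewrite !series_expE; try exact: ordZ.
have psumZ (c : k) :
    psum (exp_coef k) (c *: P) = psum (fun n => exp_coef k n * c ^+ n) P.
  by congr osum; apply/funext => n; rewrite exprZn scalerA.
rewrite !psumZ psumM //; congr (psum _ P); apply/funext => n.
exact: exp_coef_conv.
Qed.

Lemma exp0 : series_exp (0 : series k I) = 1.
Proof.
rewrite series_expE; last exact: ord_0.
apply/funext => w; rewrite /psum /osum big_ord_recl expr0 /exp_coef fact0 invr1.
rewrite scale1r big1 ?addr0 // => i _.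
by rewrite /= exprS mul0r scaler0.
Qed.

Lemma expNr P : ord 1 P -> series_exp P * series_exp (- P) = 1.
Proof.
move=> oP; rewrite -{1}(scale1r P) -scaleN1r expD // subrr scale0r.
exact: exp0.
Qed.

Lemma expNl P : ord 1 P -> series_exp (- P) * series_exp P = 1.
Proof. by move=> oP; rewrite -{2}(opprK P) expNr //; apply: ordN. Qed.

End ExpLog.

(** * Lie series *)

Section LieSeries.
Variables (k : fieldType) (I : Type).
Implicit Types (P Q R g h : series k I) (w : seq I) (m n : nat).

Definition lie_br P Q : series k I := P * Q - Q * P.

Lemma lie_closed_Lie : lie_closed (Lie k I).
Proof.
split=> [|a P Q LP LQ|P Q LP LQ|J P sP LP] S [cS XS]; have [c0 cD cB cs] := cS.
- exact: c0.
- by apply: cD; [apply: LP|apply: LQ].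
- by apply: cB; [apply: LP|apply: LQ].
- by apply: cs => // j; apply: LP.
Qed.

Lemma Lie_ind (S : set (series k I)) : lie_closed S ->
  (forall i, S (series_var i)) -> forall P, Lie k I P -> S P.
Proof. by move=> cS XS P; apply; split=> // _ [i _ <-]. Qed.

Lemma Lie_var i : Lie k I (series_var i).
Proof. by move=> S [cS XS]; apply: XS; exists i. Qed.

Lemma Lie_0 : Lie k I 0. Proof. by case: lie_closed_Lie. Qed.

Lemma Lie_lin (a : k) P Q : Lie k I P -> Lie k I Q -> Lie k I (a *: P + Q).
Proof. by case: lie_closed_Lie => _ + _ _; apply. Qed.

Lemma Lie_br P Q : Lie k I P -> Lie k I Q -> Lie k I (lie_br P Q).
Proof. by case: lie_closed_Lie => _ _ + _; apply. Qed.

Lemma LieD P Q : Lie k I P -> Lie k I Q -> Lie k I (P + Q).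
Proof. by move=> LP LQ; rewrite -(scale1r P); apply: Lie_lin. Qed.

Lemma LieZ (a : k) P : Lie k I P -> Lie k I (a *: P).
Proof. by move=> LP; rewrite -[_ *: _]addr0; apply: Lie_lin Lie_0. Qed.

Lemma LieN P : Lie k I P -> Lie k I (- P).
Proof. by rewrite -scaleN1r; apply: LieZ. Qed.

Lemma LieB P Q : Lie k I P -> Lie k I Q -> Lie k I (P - Q).
Proof. by move=> LP LQ; apply: LieD LP (LieN LQ). Qed.

Lemma Lie_sum (J : Type) (r : seq J) (p : pred J) (F : J -> series k I) :
  (forall j, p j -> Lie k I (F j)) -> Lie k I (\sum_(j <- r | p j) F j).
Proof. by move=> LF; apply: big_ind => //; [apply: Lie_0|apply: LieD]. Qed.

Lemma Lie_ord1 P : Lie k I P -> ord 1 P.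
Proof.
move: P; apply: Lie_ind; last first.
  by move=> i; apply/ord1E; rewrite /series_var asboolF.
split=> [|a P Q oP oQ|P Q oP oQ|J P sP oP]; first exact: ord_0.
- exact/ordD/oQ/ordZ.
- by apply: ordB; apply/(@ord_le _ _ 1 2 _ isT)/(@ordM _ _ 1 1).
- by apply/ord1E; apply: fsbig1 => j _; apply: oP.
Qed.

Lemma summable_ord (V : nat -> series k I) : (forall j, ord j (V j)) ->
  summable setT V.
Proof.
move=> oV w; apply: (@sub_finite_set _ _ `I_(size w).+1); last exact: finite_II.
by move=> j [_ Vj] /=; rewrite ltnNge; apply/negP => /oV.
Qed.

Lemma Lie_osum (V : nat -> series k I) : (forall j, ord j (V j)) ->
  (forall j, Lie k I (V j)) -> Lie k I (osum V).
Proof.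
move=> oV LV; rewrite -series_sum_nat //.
by case: lie_closed_Lie => _ _ _; apply=> //; apply: summable_ord.
Qed.

(** [R] is [S 0] plus the telescoping sum of the differences of its approximations, which is
    summable since the n-th difference has order [n]. *)
Lemma Lie_lim R : (forall n, exists2 S, Lie k I S & ord n (R - S)) -> Lie k I R.
Proof.
move=> RS; have [S LS oS] : exists2 S : nat -> series k I,
    forall n, Lie k I (S n) & forall n, ord n (R - S n).
  have /choice[S hS] : forall n, exists S, Lie k I S /\ ord n (R - S).
    by move=> n; have [S] := RS n; exists S.
  by exists S => n; case: (hS n).
have oV n : ord n (S n.+1 - S n).
  apply: ord_trans (oS n); apply/ord_sym/(ord_le (leqnSn n))/oS.
have -> : R = S 0%N + osum (fun n => S n.+1 - S n).
  apply/eqP; rewrite addrC -subr_eq; apply/eqP/osum_unique => // N.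
  rewrite -(big_mkord xpredT (fun n => S n.+1 - S n)) telescope_sumr //.
  by rewrite opprB addrA subrK.
by apply: LieD => //; apply: Lie_osum => // j; apply: LieB.
Qed.

(** Common form of the homogeneous part [hpart] and of the retraction [erase]. *)
Definition filt (c : pred (seq I)) P : series k I :=
  fun w => if c w then P w else 0.

Lemma filtD c P Q : filt c (P + Q) = filt c P + filt c Q.
Proof.
by apply/funext => w; rewrite seriesDE /filt; case: ifP; rewrite ?addr0.
Qed.

Lemma filtZ c (a : k) P : filt c (a *: P) = a *: filt c P.
Proof.
by apply/funext => w; rewrite seriesZE /filt; case: ifP; rewrite ?mulr0.
Qed.

Lemma filtN c P : filt c (- P) = - filt c P.
Proof. by rewrite -!scaleN1r filtZ. Qed.

Lemma filtB c P Q : filt c (P - Q) = filt c P - filt c Q.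
Proof. by rewrite filtD filtN. Qed.

Lemma filt0 c : filt c 0 = 0.
Proof. by rewrite -(scale0r 0) filtZ !scale0r. Qed.

Lemma filt_sum c (J : Type) (r : seq J) (p : pred J) (F : J -> series k I) :
  filt c (\sum_(j <- r | p j) F j) = \sum_(j <- r | p j) filt c (F j).
Proof. exact: (big_morph _ (filtD c) (filt0 c)). Qed.

Lemma filt_ord c m P : ord m P -> ord m (filt c P).
Proof. by move=> oP w wm; rewrite /filt oP // if_same. Qed.

Lemma filt_summable c (J : Type) (P : J -> series k I) :
  summable setT P -> summable setT (fun j => filt c (P j)).
Proof.
move=> sP w; apply: sub_finite_set (sP w) => j [_]; rewrite /filt.
by case: ifP.
Qed.

Lemma filt_series_sum c (J : Type) (P : J -> series k I) :
  filt c (series_sum setT P) = series_sum setT (fun j => filt c (P j)).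
Proof.
apply/funext => w; rewrite /series_sum /filt; case: ifP => // _.
by rewrite fsbig1.
Qed.

Lemma filt_var c i :
  filt c (series_var i) = if c [:: i] then series_var i else 0.
Proof.
apply/funext => w; rewrite /filt; case: (boolP (c [:: i])) => ci;
  case: ifP => //;
  by rewrite /series_var => cw; case: asboolP cw ci => // ->  ->.
Qed.

Definition hpart n P := filt (fun w => size w == n) P.

Lemma hpart_ord n P : ord n (hpart n P).
Proof.
by move=> w wn; rewrite /hpart /filt; case: eqP wn => // ->; rewrite ltnn.
Qed.

Lemma sub_hpart n P : ord n P -> ord n.+1 (P - hpart n P).
Proof.
move=> oP w; rewrite ltnS seriesDE seriesNE /hpart /filt leq_eqVlt.
by case: eqP => [_ _|_ /= /oP->]; rewrite ?subrr ?subr0.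
Qed.

Lemma hpart_sum N P : ord N (P - \sum_(j < N) hpart j P).
Proof.
move=> w wN; rewrite seriesDE seriesNE sumE (bigD1 (Ordinal wN)) //=.
rewrite {1}/hpart {1}/filt eqxx big1 ?addr0 ?subrr // => j jw.
by rewrite /hpart /filt -val_eqE eq_sym in jw *; rewrite (negbTE jw).
Qed.

Lemma hpartM n P Q :
  hpart n (P * Q) = \sum_(a < n.+1) hpart a P * hpart (n - a) Q.
Proof.
apply/funext => w; rewrite sumE /hpart {1}/filt; case: eqP => [wn|wn].
  rewrite seriesME wn; apply: eq_bigr => a _.
  rewrite seriesME wn (bigD1 a) //= {1 2}/filt size_take size_drop wn.
  have -> : (if a < n then a : nat else n)%N = a.
    by case: ltngtP (leq_ord a).
  rewrite !eqxx big1 ?addr0 // => j ja.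
  rewrite /filt size_take wn; have -> : (if j < n then j : nat else n)%N = j.
    by case: ltngtP (leq_ord j).
  by move: ja; rewrite -val_eqE /= => /negbTE->; rewrite mul0r.
rewrite big1 // => a _; rewrite seriesME big1 // => j _; rewrite /filt.
case: eqP => [ta|]; last by rewrite mul0r.
case: eqP => [da|]; last by rewrite mulr0.
by case: wn; rewrite -(cat_take_drop j w) size_cat ta da subnKC // leq_ord.
Qed.

Lemma hpart_br n P Q :
  hpart n (lie_br P Q) = \sum_(a < n.+1) lie_br (hpart a P) (hpart (n - a) Q).
Proof.
rewrite /lie_br [LHS]filtB -!/(hpart _ _) !hpartM sumrB; congr (_ - _).
rewrite (reindex_inj rev_ord_inj) /=; apply: eq_bigr => a _.
by rewrite subSS subKn // leq_ord.
Qed.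

(** The induction treats all [c t] simultaneously, because one homogeneous part of a bracket
    involves parts of several degrees of its factors. *)
Lemma Lie_filt (T : Type) (c : T -> pred (seq I)) :
  (forall P Q, (forall t, Lie k I (filt (c t) P)) ->
    (forall t, Lie k I (filt (c t) Q)) ->
    forall t, Lie k I (filt (c t) (lie_br P Q))) ->
  forall P t, Lie k I P -> Lie k I (filt (c t) P).
Proof.
move=> cB P t LP; move: t.
move: P LP; apply: Lie_ind => [|i t]; last first.
  by rewrite filt_var; case: ifP => _; [apply: Lie_var|apply: Lie_0].
split=> [t|a P Q LP LQ t|P Q LP LQ|J P sP LP t].
- by rewrite filt0; apply: Lie_0.
- by rewrite filtD filtZ; apply: Lie_lin.
- exact: cB.
rewrite filt_series_sum; case: lie_closed_Lie => _ _ _; apply=> [|j] //.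
exact: filt_summable.
Qed.

Lemma Lie_hpart n P : Lie k I P -> Lie k I (hpart n P).
Proof.
apply: (@Lie_filt _ (fun n w => size w == n)) => {}P Q LP LQ {}n.
rewrite -/(hpart _ _) hpart_br; apply: Lie_sum => a _.
by apply: Lie_br; [apply: LP|apply: LQ].
Qed.

Lemma hpart_eq n P Q : ord n.+1 (P - Q) -> hpart n P = hpart n Q.
Proof.
move=> oPQ; apply/funext => w; rewrite /hpart /filt; case: eqP => // wn.
by apply/eqP; rewrite -subr_eq0; apply/eqP/oPQ; rewrite wn.
Qed.

End LieSeries.

(** * The group of exponentials of Lie series *)

Section Euler.
Variables (k : fieldType) (I : Type).
Implicit Types (P Q R g h : series k I) (w : seq I) (m n : nat).

Definition euler P : series k I := fun w => (size w)%:R * P w.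

Lemma eulerB P Q : euler (P - Q) = euler P - euler Q.
Proof. by apply/funext => w; rewrite seriesDE seriesNE /euler -mulrBr. Qed.

Lemma eulerM P Q : euler (P * Q) = euler P * Q + P * euler Q.
Proof.
apply/funext => w; rewrite seriesDE !seriesME /euler mulr_sumr -big_split.
apply: eq_bigr => j _ /=; rewrite mulrCA -!mulrA [P _ * (_ * _)]mulrCA.
rewrite [LHS]mulrCA -mulrDl -natrD.
by rewrite -size_cat cat_take_drop.
Qed.

Lemma euler1 : euler 1 = 0.
Proof.
apply/funext => -[|x w]; first by rewrite /euler mul0r.
by rewrite /euler mulr0.
Qed.

Lemma euler_ord m P : ord m P -> ord m (euler P).
Proof. by move=> oP w wm; rewrite /euler oP // mulr0. Qed.

Lemma euler_osum (V : nat -> series k I) :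
  euler (osum V) = osum (fun n => euler (V n)).
Proof. by apply/funext => w; rewrite /euler /osum mulr_sumr. Qed.

Lemma eulerZ (a : k) P : euler (a *: P) = a *: euler P.
Proof. by apply/funext => w; rewrite /euler !seriesZE mulrCA. Qed.

Lemma hpart_euler n P : hpart n (euler P) = n%:R *: hpart n P.
Proof.
apply/funext => w; rewrite seriesZE /hpart /filt /euler.
by case: eqP => [->|_]; rewrite ?mulr0.
Qed.

Lemma Lie_euler P : Lie k I P -> Lie k I (euler P).
Proof.
move=> LP; apply: Lie_lim => n; exists (\sum_(j < n) hpart j (euler P)).
  by apply: Lie_sum => j _; rewrite hpart_euler; apply: LieZ (Lie_hpart _ LP).
exact: hpart_sum.
Qed.

End Euler.

Section AdExp.
Variables (k : fieldType) (I : Type).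
Hypothesis char0 : [pchar k] =i pred0.
Implicit Types (P Q R g h U : series k I) (w : seq I) (m n : nat).

(* For [D = 0], this expands [R ^+ m * V 0] in terms of [V j = (ad R)^j (V 0)];
   for [V 0 = 0] and [D = euler R], it expands [T m = euler (R ^+ m)] in terms of
   [V j.+1 = (ad R)^j D]. *)
Lemma ad_expansion (A : pzRingType) (R D : A) (V T : nat -> A) :
  T 0%N = V 0%N -> (forall m, T m.+1 = R * T m + D * R ^+ m) ->
  V 1%N + V 0%N * R = R * V 0%N + D ->
  (forall j, V j.+2 + V j.+1 * R = R * V j.+1) ->
  forall m, T m = \sum_(j < m.+1) V j * R ^+ (m - j) *+ 'C(m, j).
Proof.
move=> T0 TS V1 VS; elim=> [|m IH]; first by rewrite big_ord1 expr0 mulr1 T0.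
have -> : T m.+1 = \sum_(j < m.+1) (V j.+1 + V j * R) * R ^+ (m - j) *+ 'C(m, j).
  rewrite TS IH mulr_sumr !big_ord_recl /= addrAC subn0 !bin0 !mulr1n V1.
  rewrite mulrDl mulrA; congr (_ + _); apply: eq_bigr => j _.
  by rewrite VS mulrnAr mulrA.
under eq_bigr do rewrite mulrDl mulrnDl.
rewrite big_split /= addrC [RHS]big_ord_recl subn0 bin0 mulr1n.
rewrite [X in X + _]big_ord_recl subn0 bin0 mulr1n -mulrA -exprS -addrA.
congr (_ + _); rewrite [X in _ = X]big_ord_recr /=.
rewrite [X in _ + X = _]big_ord_recr /= addrA; congr (_ + _); last first.
  by rewrite !subnn !binn.
rewrite -big_split /=; apply: eq_bigr => j _.
rewrite binS mulrnDr /bump /= add1n subSS; congr (_ + _).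
by rewrite -mulrA -exprS subnSK.
Qed.

Definition ad R U n : series k I := iter n (lie_br R) U.

Lemma ad_ord R U m n : ord 1 R -> ord m U -> ord (n + m) (ad R U n).
Proof.
move=> oR oU; elim: n => //= n IH; apply: ordB; rewrite addSn.
  exact: (@ordM _ _ 1).
by rewrite -addn1; apply: ordM.
Qed.

Lemma ad_ord0 R U n : ord 1 R -> ord n (ad R U n).
Proof. by move/(@ad_ord _ U 0 n); rewrite addn0; apply. Qed.

Lemma Lie_ad R U n : Lie k I R -> Lie k I U -> Lie k I (ad R U n).
Proof. by move=> LR LU; elim: n => //= n; apply: Lie_br. Qed.

(** After division by factorials, the binomial sum of [ad_expansion] is a Cauchy product with the
    exponential series. *)
Lemma osum_exp R D (V T : nat -> series k I) : ord 1 R ->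
  (forall j, ord j (V j)) ->
  T 0%N = V 0%N -> (forall m, T m.+1 = R * T m + D * R ^+ m) ->
  V 1%N + V 0%N * R = R * V 0%N + D ->
  (forall j, V j.+2 + V j.+1 * R = R * V j.+1) ->
  osum (fun m => exp_coef k m *: T m) =
  osum (fun j => exp_coef k j *: V j) * series_exp R.
Proof.
move=> oR oV T0 TS V1 VS; rewrite series_expE // /psum osumM; last first.
- by move=> j; apply/ordZ/ord1X.
- by move=> j; apply/ordZ.
congr osum; apply/funext => n; rewrite (ad_expansion T0 TS V1 VS) scaler_sumr.
apply: eq_bigr => j _; rewrite -scalerAl -scalerAr scalerA -scaler_nat scalerA.
congr (_ *: _); apply: (mulfI (fact_neq0 char0 n)).
rewrite /exp_coef mulVKf ?fact_neq0 // -(bin_fact (leq_ord j)) !natrM -invfM.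
by rewrite mulfK // mulf_neq0 // fact_neq0.
Qed.

Lemma osum_mulr (V : nat -> series k I) P : (forall j, ord j (V j)) ->
  osum V * P = osum (fun j => V j * P).
Proof.
move=> oV; apply: osum_unique => [j|N]; first exact: ordMr.
by rewrite -mulr_suml -mulrBl; apply/ordMr/ord_osum.
Qed.

(** [U'] is exp(ad R) applied to [U], a sum of iterated brackets. *)
Lemma exp_conj R U : Lie k I R -> Lie k I U ->
  exists2 U', Lie k I U' & series_exp R * U = U' * series_exp R.
Proof.
move=> LR LU; have oR := Lie_ord1 LR.
exists (osum (fun j => exp_coef k j *: ad R U j)).
  by apply: Lie_osum => j; [apply/ordZ/ad_ord0|apply: LieZ (Lie_ad _ LR LU)].
rewrite -(@osum_exp R 0 (ad R U) (fun m => R ^+ m * U) oR).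
- rewrite series_expE // /psum osum_mulr; last by move=> j; apply/ordZ/ord1X.
  by congr osum; apply/funext => j; rewrite scalerAl.
- by move=> j; apply: ad_ord0.
- by rewrite expr0 mul1r.
- by move=> m; rewrite mul0r addr0 exprS mulrA.
- by rewrite addr0 /= /lie_br subrK.
by move=> j; rewrite [ad _ _ j.+2]/= {1}/lie_br subrK.
Qed.

(** [U] is the sum of (ad R)^j (euler R) / (j+1)!, the noncommutative logarithmic derivative of the
    exponential. *)
Lemma exp_euler R : Lie k I R ->
  exists2 U, Lie k I U & euler (series_exp R) = U * series_exp R.
Proof.
move=> LR; have oR := Lie_ord1 LR; have LE := Lie_euler LR.
(* The shift by one index makes [exp_coef] supply the denominators (j+1)!. *)
pose V n := if n is m.+1 then ad R (euler R) m else 0.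
have oV j : ord j (V j).
  by case: j => //= j; rewrite -addn1; apply: ad_ord => //; apply: Lie_ord1.
exists (osum (fun j => exp_coef k j *: V j)).
  apply: Lie_osum => [j|[|j]]; first exact: ordZ.
    by rewrite scaler0; apply: Lie_0.
  exact: LieZ (Lie_ad _ LR LE).
rewrite -(@osum_exp R (euler R) V (fun m => euler (R ^+ m))) //=.
- rewrite series_expE // /psum euler_osum.
  by congr osum; apply/funext => j; rewrite eulerZ.
- by rewrite expr0 euler1.
- by move=> m; rewrite exprS eulerM addrC.
- by rewrite mul0r mulr0 addr0 add0r.
by move=> j; rewrite /lie_br subrK.
Qed.

(* If [log g] agrees with a Lie series [S] below degree [n], then the leading
   term of [exp (- S) * g - 1] is that of [log g - S], and [n] times it is the
   degree [n] part of the logarithmic derivative of [exp (- S) * g], which is a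
   Lie series. *)
Lemma log_Lie g U : ord 1 (g - 1) -> Lie k I U -> euler g = U * g ->
  Lie k I (series_log g).
Proof.
move=> og LU Eg; apply: Lie_lim; elim=> [|n [S LS oS]].
  by exists 0 => //; apply: Lie_0.
have olog := ord1_log og.
(* Degree 0 is settled apart, since the correction below divides by the degree. *)
case: n oS => [|n] oS; first by exists 0; [apply: Lie_0|rewrite subr0].
have LNS := LieN LS; have oNS := Lie_ord1 LNS.
have [U1 LU1 EU1] := exp_euler LNS; have [U2 LU2 EU2] := exp_conj LNS LU.
pose g' := series_exp (- S) * g; pose D := series_log g - S.
have Eg' : euler g' = (U1 + U2) * g'.
  by rewrite /g' eulerM EU1 Eg mulrA EU2 mulrDl !mulrA.
have gSD : ord n.+2 (g - series_exp S - D).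
  by have := exp_sub (Lie_ord1 LS) olog oS; rewrite logK.
have gS : ord n.+1 (g - series_exp S).
  by apply: ord_congr oS; apply: ord_le gSD.
have g'D : ord n.+2 (g' - 1 - D).
  have -> : g' - 1 - D =
      (series_exp (- S) - 1) * (g - series_exp S) + (g - series_exp S - D).
    rewrite mulrBl mul1r mulrBr expNl ?subrK //; last exact: Lie_ord1.
    by rewrite addrA subrK.
  by apply: ordD gSD; apply: (@ordM _ _ 1) gS; apply: ord1_exp.
have g'1 : ord n.+1 (g' - 1) by apply: ord_congr oS; apply: ord_le g'D.
(* Here [g'] may be replaced by 1: it differs from 1 in order [n.+1], and [U1 + U2] has no constant
   term. *)
have UD : ord n.+2 (U1 + U2 - euler D).
  apply: ord_trans (_ : ord n.+2 (euler g' - euler D)).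
    rewrite Eg' -{1}[U1 + U2]mulr1 -mulrBr -opprB mulrN; apply: ordN.
    by apply: (@ordM _ _ 1) g'1; apply: Lie_ord1 (LieD LU1 LU2).
  have := euler_ord g'D; rewrite eulerB [euler (g' - 1)]eulerB euler1 subr0.
  by [].
exists (S + n.+1%:R^-1 *: hpart n.+1 (U1 + U2)).
  by apply: LieD => //; apply: LieZ (Lie_hpart _ (LieD LU1 LU2)).
rewrite (hpart_eq UD) hpart_euler scalerA mulVf ?natS_neq0 // scale1r.
by rewrite opprD addrA; apply: sub_hpart.
Qed.

Lemma Gr_exp R : Lie k I R -> Gr k I (series_exp R).
Proof. by exists R. Qed.

Lemma Gr_ord1 g : Gr k I g -> ord 1 (g - 1).
Proof. by case=> R /Lie_ord1 oR <-; apply: ord1_exp. Qed.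

Lemma Gr_log g : Gr k I g -> Lie k I (series_log g).
Proof. by case=> R LR <-; rewrite expK //; apply: Lie_ord1. Qed.

Lemma Gr_logK g : Gr k I g -> series_exp (series_log g) = g.
Proof. by move=> Gg; have og := Gr_ord1 Gg; apply: logK. Qed.

Lemma Gr1 : Gr k I 1.
Proof. by rewrite -(exp0 k I); exact: (Gr_exp (@Lie_0 k I)). Qed.

(** The logarithmic derivative of a product g h is U1 + g U2 g^-1, where U1 and U2 are those of the
    factors; it is a Lie series by [exp_conj], and [log_Lie] applies. *)
Lemma GrM g h : Gr k I g -> Gr k I h -> Gr k I (g * h).
Proof.
move=> [R LR <-] [S LS <-]; set g' := series_exp R; set h' := series_exp S.
have og : ord 1 (g' * h' - 1).
  rewrite -(subrKA h') -{2}(mul1r h') -mulrBl; apply: ordD.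
    by apply: ordMr; apply: ord1_exp; apply: Lie_ord1.
  by apply: ord1_exp; apply: Lie_ord1.
have [U1 LU1 EU1] := exp_euler LR; have [U2 LU2 EU2] := exp_euler LS.
have [U3 LU3 EU3] := exp_conj LR LU2.
rewrite -(logK char0 og).
apply: Gr_exp (log_Lie og (LieD LU1 LU3) _).
by rewrite eulerM EU1 EU2 mulrA EU3 mulrDl !mulrA.
Qed.

Lemma Gr_pow g (a : k) : Gr k I g -> Gr k I (series_pow g a).
Proof. by move=> Gg; apply: Gr_exp (LieZ _ (Gr_log Gg)). Qed.

Lemma Gr_inv g : Gr k I g -> exists h, [/\ Gr k I h, g * h = 1 & h * g = 1].
Proof.
case=> R LR <-; exists (series_exp (- R)).
by split; [apply: Gr_exp (LieN LR)|apply: expNr|apply: expNl]=> //;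
  apply: Lie_ord1.
Qed.

Lemma Gr_prod (J : Type) (r : seq J) (p : pred J) (F : J -> series k I) :
  (forall j, p j -> Gr k I (F j)) -> Gr k I (\prod_(j <- r | p j) F j).
Proof. by move=> GF; apply: big_ind => //; [apply: Gr1|apply: GrM]. Qed.

End AdExp.

(** * Solving the equation in formal series *)

Section Equation.
Variables (k : fieldType) (I : Type).
Hypothesis char0 : [pchar k] =i pred0.
Implicit Types (P Q R F G : series k I) (m : nat).

Lemma ord1M F G : ord 1 (F - 1) -> ord 1 (G - 1) -> ord 1 (F * G - 1).
Proof.
move=> oF oG; rewrite -(subrKA G) -{2}(mul1r G) -mulrBl.
by apply: ordD oG; apply: ordMr.
Qed.

Lemma ord1_prod (J : Type) (r : seq J) (F : J -> series k I) :
  (forall j, ord 1 (F j - 1)) -> ord 1 (\prod_(j <- r) F j - 1).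
Proof.
move=> oF; apply: (big_ind (fun P => ord 1 (P - 1))) => //; last exact: ord1M.
by rewrite subrr.
Qed.

(** All factors have constant term 1, so multiplying a difference of order [m] by the other factors
    changes it only from order [m.+1] on. *)
Lemma prod_sub (J : Type) (r : seq J) (F G : J -> series k I) m :
  (forall j, ord 1 (F j - 1)) -> (forall j, ord 1 (G j - 1)) ->
  (forall j, ord m (G j - F j)) ->
  ord m.+1 (\prod_(j <- r) G j - \prod_(j <- r) F j -
    \sum_(j <- r) (G j - F j)).
Proof.
move=> oF oG oGF; elim: r => [|x r IH]; first by rewrite !big_nil !subrr.
rewrite !big_cons; move: IH (ord1_prod r oG).
set PG := \prod_(j <- r) _; set PF := \prod_(j <- r) _.
set S := \sum_(j <- r) _.
move=> IH oPG.
have oPGF : ord m (PG - PF).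
  apply: ord_congr (ord_le (leqnSn m) IH) _.
  by apply: ord_sum => j _; apply: oGF.
have -> : G x * PG - F x * PF - (G x - F x + S) =
    (G x - F x) * (PG - 1) + ((F x - 1) * (PG - PF) + (PG - PF - S)).
  rewrite [(F x - 1) * _]mulrBl mul1r subrKA [(_ - _) * (PG - 1)]mulrBr mulr1.
  by rewrite addrACA -opprD mulrBl mulrBr subrKA.
apply: ordD; first by rewrite -addn1; apply: ordM.
by apply: ordD => //; apply: (@ordM _ _ 1).
Qed.

Lemma pow_sub F G (a : k) m : ord 1 (F - 1) -> ord 1 (G - 1) ->
  ord m (G - F) ->
  ord m.+1 (series_pow G a - series_pow F a - a *: (G - F)).
Proof.
move=> oF oG oGF; have oGFl := log_sub oF oG oGF.
have oZ : ord m.+1 (a *: series_log G - a *: series_log F - a *: (G - F)).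
  by rewrite -!scalerBr; apply: ordZ.
have oP : ord 1 (a *: series_log F) by apply/ordZ/ord1_log.
have oQ : ord 1 (a *: series_log G) by apply/ordZ/ord1_log.
have oPQ : ord m (a *: series_log G - a *: series_log F).
  by apply: ord_congr (ord_le (leqnSn m) oZ) _; apply: ordZ.
exact: ord_trans (exp_sub oP oQ oPQ) oZ.
Qed.

Lemma ord1_pow F (a : k) : ord 1 (F - 1) -> ord 1 (series_pow F a - 1).
Proof. by move=> oF; apply: ord1_exp; apply/ordZ/ord1_log. Qed.

Variables (n : nat) (l : 'I_n -> k) (A : 'I_n -> series k I).
Hypothesis A_Gr : forall i, Gr k I (A i).

Definition lhs F := \prod_(i < n) (A i * series_pow F (l i)).

Lemma ord1_lhs F : ord 1 (F - 1) -> ord 1 (lhs F - 1).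
Proof.
move=> oF; apply: ord1_prod => i; apply: ord1M; first exact: Gr_ord1.
exact: ord1_pow.
Qed.

Lemma lhs_sub F G m : ord 1 (F - 1) -> ord 1 (G - 1) -> ord m (G - F) ->
  ord m.+1 (lhs G - lhs F - (\sum_i l i) *: (G - F)).
Proof.
move=> oF oG oGF; have pFG a := pow_sub a oF oG oGF.
have oa a : ord m (series_pow G a - series_pow F a).
  by apply: ord_congr (ord_le (leqnSn m) (pFG a)) _; apply: ordZ.
apply: ord_trans (prod_sub _ _ _ _) _ => [i|i|i|].
- by apply: ord1M; [apply: Gr_ord1|apply: ord1_pow].
- by apply: ord1M; [apply: Gr_ord1|apply: ord1_pow].
- by rewrite -mulrBr; apply: ordMl.
rewrite scaler_suml -sumrB; apply: ord_sum => i _.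
rewrite -mulrBr.
rewrite -[X in ord _ (X - _)](subrK (series_pow G (l i) - series_pow F (l i))).
rewrite -{2}[series_pow G _ - _]mul1r -mulrBl -addrA; apply: ordD => //.
by apply: (@ordM _ _ 1) => //; apply: Gr_ord1.
Qed.

Lemma Gr_lhs F : Gr k I F -> Gr k I (lhs F).
Proof.
by move=> GF; apply: (Gr_prod char0) => i _; apply: (GrM char0) (Gr_pow _ _ GF).
Qed.

Hypothesis suml_neq0 : \sum_i l i != 0.

(** Newton's method for the logarithm of the unknown, with the derivative frozen at its leading
    value [\sum_i l i]. *)
Definition newton P := P - (\sum_i l i)^-1 *: series_log (lhs (series_exp P)).

(** Exponential, [lhs] and logarithm multiply leading differences by 1, the sum of the [l i], and 1;
    the subtraction then cancels the leading term. *)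
Lemma newton_sub P Q m : ord 1 P -> ord 1 Q -> ord m (Q - P) ->
  ord m.+1 (newton Q - newton P).
Proof.
move=> oP oQ oQP; have eQP := exp_sub oP oQ oQP.
have oeP := ord1_exp oP; have oeQ := ord1_exp oQ.
have oE : ord m (series_exp Q - series_exp P).
  by apply: ord_congr (ord_le (leqnSn m) eQP) _.
have lQP := lhs_sub oeP oeQ oE.
have oL : ord m (lhs (series_exp Q) - lhs (series_exp P)).
  by apply: ord_congr (ord_le (leqnSn m) lQP) _; apply: ordZ.
have gQP := log_sub (ord1_lhs oeP) (ord1_lhs oeQ) oL.
have ZQP : ord m.+1 ((\sum_i l i) *: (series_exp Q - series_exp P) -
    (\sum_i l i) *: (Q - P)) by rewrite -scalerBr; apply: ordZ.
have oX := ord_trans (ord_trans gQP lQP) ZQP.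
have -> : newton Q - newton P = - (\sum_i l i)^-1 *:
    (series_log (lhs (series_exp Q)) - series_log (lhs (series_exp P))
     - (\sum_i l i) *: (Q - P)).
  rewrite scaleNr scalerBr scalerA mulVf // scale1r opprB scalerBr opprB.
  rewrite /newton.
  by rewrite opprB addrACA [- _ - P]addrC addrACA.
exact: ordZ.
Qed.

Lemma Lie_newton P : Lie k I P -> Lie k I (newton P).
Proof.
move=> LP; apply: LieB LP (LieZ _ (Gr_log char0 (Gr_lhs (Gr_exp LP)))).
Qed.

Lemma lhs_solution : exists2 F, Gr k I F & lhs F = 1.
Proof.
have [Y Y0 YE] : exists2 Y, Y 0%N = 0 & forall j, Y j.+1 = newton (Y j).
  by exists (fun j => iter j newton 0).
have LY j : Lie k I (Y j).
  elim: j => [|j IH]; first by rewrite Y0; apply: Lie_0.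
  by rewrite YE; apply: Lie_newton.
have oY j := Lie_ord1 (LY j).
have YS j : ord j (Y j.+1 - Y j).
  elim: j => [|j IH]; first exact: ord_all.
  by rewrite (YE j.+1) {2}YE; apply: newton_sub (oY j) (oY j.+1) IH.
have Ylim i j : (i <= j)%N -> ord i (Y j - Y i).
  elim: j => [|j IH]; first by rewrite leqn0 => /eqP->.
  rewrite leq_eqVlt => /predU1P[->|ij]; first by rewrite subrr.
  by apply: ord_trans (IH ij); apply: ord_le (YS j).
(* The values of the iterates at [w] no longer change from index [(size w).+1] on. *)
pose Z : series k I := fun w => Y (size w).+1 w.
have oZ j : ord j (Z - Y j).
  move=> w wj; have /eqP := Ylim _ _ wj w (ltnSn _).
  rewrite !seriesDE !seriesNE subr_eq0 => /eqP Yw.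
  by rewrite /Z -Yw subrr.
have LZ : Lie k I Z by apply: Lie_lim => j; exists (Y j).
have fixZ : newton Z = Z.
  apply: ord_sep => j; apply: (@ord_trans _ _ _ _ (Y j.+1)).
    rewrite YE; apply: (ord_le (leqnSn j)).
    exact: newton_sub (oY j) (Lie_ord1 LZ) (oZ j).
  by apply: ord_sym; apply: (ord_le (leqnSn j)).
have GZ := Gr_exp LZ; exists (series_exp Z) => //.
rewrite -(Gr_logK char0 (Gr_lhs GZ)).
suff -> : series_log (lhs (series_exp Z)) = 0 by apply: exp0.
move/eqP: fixZ; rewrite -subr_eq0 /newton addrC addKr oppr_eq0 scaler_eq0.
by rewrite invr_eq0 (negbTE suml_neq0) => /eqP.
Qed.

End Equation.

(** * Infinite products and erasing a variable *)

Section InfiniteProduct.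
Variables (k : fieldType) (I : Type).

Fact gtn_irr : irreflexive gtn. Proof. by move=> j; apply: ltnn. Qed.

Fact gtn_trans : transitive gtn.
Proof. by move=> j i m ij jm; apply: ltn_trans jm ij. Qed.

Fact gtn_total i j : i <> j -> gtn i j || gtn j i.
Proof. by move=> /eqP; rewrite neq_ltn orbC. Qed.

(** Larger indices come first, since each new factor is split off to the left of the previous
    ones. *)
Definition gtn_order : linear_order nat :=
  LinearOrder gtn_irr gtn_trans gtn_total.

(** Index set of the expansion of the product of the [1 + (Q j - 1)] for [j < n], larger [j] on the
    left. *)
Fixpoint decr_seqs n : seq (seq nat) :=
  if n is m.+1 then decr_seqs m ++ map (cons m) (decr_seqs m) else [:: [::]].

Lemma mem_decr_seqs n s : (s \in decr_seqs n) = sorted gtn s && all (gtn n) s.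
Proof.
elim: n s => [|n IH] s; first by case: s => [|x s] //=; rewrite andbF.
rewrite mem_cat IH; case: s => [|x s] /=; first by [].
rewrite (path_sortedE gtn_trans).
have -> : (x :: s \in map (cons n) (decr_seqs n)) =
    (x == n) && (s \in decr_seqs n).
  apply/mapP/andP => [[s' s'n [-> ->]]|[/eqP-> sn]]; last by exists s.
  by rewrite eqxx.
rewrite IH ltnS (leq_eqVlt x); case: (ltngtP x n) => //= xn.
- rewrite orbF; case: (boolP (all (gtn x) s)) => //= sx.
  case: (sorted gtn s) => //=.
  rewrite (sub_all _ sx) /= => [|i /= ix]; last exact: ltn_trans ix xn.
  symmetry; apply: sub_all sx => i /= ix.
  exact: leq_trans ix (leqW (ltnW xn)).
- by rewrite !andbF.
rewrite andbF /= xn andbC; case: (boolP (all (gtn n) s)) => //= sn.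
by rewrite (sub_all _ sn) ?andbT // => i /=; apply: leqW.
Qed.

Lemma uniq_decr_seqs n : uniq (decr_seqs n).
Proof.
elim: n => //= n IH; rewrite cat_uniq IH map_inj_uniq ?IH => [|s t []//].
rewrite andbT; apply/hasPn => _ /mapP[s _ ->].
by rewrite mem_decr_seqs /= ltnn /= andbF.
Qed.

Lemma ord_prod_mem (Q : nat -> series k I) (s : seq nat) j :
  (forall i, ord i.+1 (Q i - 1)) -> j \in s ->
  ord j.+1 (\prod_(i <- s) (Q i - 1)).
Proof.
move=> oQ; elim: s => // x s IH; rewrite inE big_cons => /predU1P[->|js].
  exact: ordMr.
by apply: ordMl; apply: IH.
Qed.

(** The remainders [B n] tend to 1, so [B 0] is the limit of the partial products [P n]; a
    decreasing sequence with an entry at least [n] contributes only beyond degree [n]. *)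
Lemma series_prod_lim (Q B : nat -> series k I) :
  (forall n, ord n.+1 (Q n - 1)) -> (forall n, ord n.+1 (B n - 1)) ->
  (forall n, B n = B n.+1 * Q n) -> series_prod gtn_order Q = B 0%N.
Proof.
move=> oQ oB BS; pose P := fix P n := if n is m.+1 then Q m * P m else 1.
have BP n : B 0%N = B n * P n.
  by elim: n => [|n IH]; rewrite ?mulr1 // IH BS -mulrA.
have sumP n : \sum_(s <- decr_seqs n) \prod_(j <- s) (Q j - 1) = P n.
  elim: n => [|n IH]; first by rewrite big_seq1 big_nil.
  rewrite big_cat big_map /=; under [X in _ + X]eq_bigr do rewrite big_cons.
  by rewrite -mulr_sumr !IH mulrBl mul1r addrC subrK.
apply: ord_sep => n; apply: (@ord_trans _ _ _ _ (P n)); last first.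
  rewrite (BP n) -{1}[P n]mul1r -mulrBl; apply: ordMr; apply: ord_sym.
  exact/(ord_le (leqnSn n))/oB.
move=> w wn; rewrite seriesDE seriesNE -sumP sumE /series_prod /series_sum.
rewrite (@fsum_seq _ _ _ (decr_seqs n)) ?subrr //.
- by rewrite uniq_classic uniq_decr_seqs.
- by move=> s; rewrite mem_classic mem_decr_seqs => /andP[].
move=> s /= ss; rewrite mem_classic mem_decr_seqs.
rewrite (ss : sorted gtn s) /= -has_predC => /hasP[j js /=].
rewrite -leqNgt => nj.
by apply: (ord_prod_mem oQ js); apply: (leq_trans wn); apply: leqW.
Qed.

End InfiniteProduct.

Section Retraction.
Variables (k : fieldType) (I : eqType) (z : I).
Hypothesis char0 : [pchar k] =i pred0.
Implicit Types (P Q R g h : series k I) (w : seq I) (m n : nat).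

(** The algebra endomorphism that substitutes 0 for the variable [z]. *)
Definition erase P := filt (fun w => z \notin w) P.

Lemma eraseM P Q : erase (P * Q) = erase P * erase Q.
Proof.
apply/funext => w; rewrite /erase {1}/filt !seriesME; case: ifP => zw.
  apply: eq_bigr => j _; move: zw; rewrite /filt -{1}(cat_take_drop j w) mem_cat.
  by rewrite negb_or => /andP[-> ->].
rewrite big1 // => j _; move: zw; rewrite /filt -{1}(cat_take_drop j w) mem_cat.
by rewrite negb_or; case: ifP; rewrite ?mul0r //= => _ ->; rewrite mulr0.
Qed.

Lemma erase1 : erase 1 = 1.
Proof. by apply/funext => -[|x w] //; rewrite /erase /filt; case: ifP. Qed.

Lemma eraseX P n : erase (P ^+ n) = erase P ^+ n.
Proof. by elim: n => [|n IH]; rewrite ?erase1 // !exprS eraseM IH. Qed.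

Lemma erase_exp P : ord 1 P -> erase (series_exp P) = series_exp (erase P).
Proof.
move=> oP; rewrite !series_expE //; last exact: filt_ord.
apply/funext => w; rewrite /erase {1}/filt /psum /osum.
rewrite -/(erase P).
under [in RHS]eq_bigr do rewrite -eraseX seriesZE /erase /filt.
case: ifP => _; first by apply: eq_bigr => j _; rewrite seriesZE.
by rewrite big1 // => j _; rewrite mulr0.
Qed.

Lemma Lie_erase P : Lie k I P -> Lie k I (erase P).
Proof.
apply: (@Lie_filt _ _ unit (fun _ w => z \notin w)) tt => {}P Q LP LQ t.
rewrite -/(erase _) /lie_br /erase filtB -!/(erase _) !eraseM.
by apply: Lie_br; [apply: LP|apply: LQ].
Qed.

Lemma erase_log g : Gr k I g -> erase (series_log g) = series_log (erase g).
Proof.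
case=> R LR <-; have oR := Lie_ord1 LR; rewrite erase_exp // !expK //.
exact: filt_ord.
Qed.

Lemma erase_pow g (a : k) : Gr k I g ->
  erase (series_pow g a) = series_pow (erase g) a.
Proof.
move=> Gg; rewrite /series_pow erase_exp.
  by rewrite /erase filtZ -!/(erase _) erase_log.
by apply: ordZ; apply: Lie_ord1; apply: Gr_log.
Qed.

End Retraction.

(** * Kernels of evaluations *)

Section LieBracket.
Variables (k : fieldType) (I : Type).
Implicit Types (P Q R : series k I).

Lemma lie_brBl P Q R : lie_br (P - Q) R = lie_br P R - lie_br Q R.
Proof. by rewrite /lie_br mulrBl mulrBr !opprD !opprK addrACA. Qed.

Lemma lie_brBr P Q R : lie_br R (P - Q) = lie_br R P - lie_br R Q.
Proof. by rewrite /lie_br mulrBl mulrBr !opprD !opprK addrACA. Qed.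

Lemma lie_br_anti P Q : lie_br P Q = - lie_br Q P.
Proof. by rewrite /lie_br opprB. Qed.

Lemma lie_br_ord m n P Q : ord m P -> ord n Q -> ord (m + n) (lie_br P Q).
Proof.
by move=> oP oQ; apply: ordB; [|rewrite addnC]; apply: ordM.
Qed.

Lemma lie_br1 P Q : lie_br (P - 1) (Q - 1) = lie_br P Q.
Proof.
by rewrite lie_brBl !lie_brBr /lie_br !(mul1r, mulr1) !subrr !subr0.
Qed.

End LieBracket.

Section Kernel.
Variables (k : fieldType) (I : finType) (z : I) (G : multExpGroupType k).
Hypothesis char0 : [pchar k] =i pred0.
Variable ev : series k I -> G.
Hypotheses (ev_hom : gr_morphism ev) (ev_mult : gr_strongly_multiplicative ev).
Implicit Types (P Q R g h : series k I) (m n : nat).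

Lemma evM P Q : Gr k I P -> Gr k I Q -> ev (P * Q) = (ev P * ev Q)%g.
Proof. by case: ev_hom => + _; apply. Qed.

Lemma ev_pow P (a : k) : Gr k I P -> ev (series_pow P a) = (ev P ^^ a)%g.
Proof. by case: ev_hom => _; apply. Qed.

Lemma ev1 : ev 1 = 1%g.
Proof.
apply: (mulgI (ev 1)); rewrite mulg1 -evM ?mulr1 //; exact: Gr1.
Qed.

Lemma pow1g (a : k) : (1 ^^ a = 1 :> G)%g.
Proof.
apply: (mulgI (1 ^^ a)%g); rewrite mulg1 -{3}(mulg1 1%g).
by rewrite powMg.
Qed.

(** The condition on [erase] lets a series that is trivial modulo [z] remain so after division by
    [Q], as the iteration in [ev_kernel] demands. *)
Definition inK Q := [/\ Gr k I Q, ev Q = 1%g & erase z Q = 1].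

Lemma inK1 : inK 1.
Proof. by split; [apply: Gr1|apply: ev1|apply: erase1]. Qed.

Lemma inKM P Q : inK P -> inK Q -> inK (P * Q).
Proof.
move=> [GP eP pP] [GQ eQ pQ]; split; first exact: GrM.
  by rewrite evM // eP eQ mulg1.
by rewrite eraseM pP pQ mulr1.
Qed.

Lemma log1 : series_log 1 = 0 :> series k I.
Proof. by rewrite -(exp0 k I) expK //; apply: ord_0. Qed.

Lemma inK_pow Q (a : k) : inK Q -> inK (series_pow Q a).
Proof.
move=> [GQ eQ pQ]; split; first exact: Gr_pow.
  by rewrite ev_pow // eQ pow1g.
by rewrite erase_pow // pQ /series_pow log1 scaler0 exp0.
Qed.

Lemma inK_comm g g' Q Q' : inK Q -> Gr k I g -> Gr k I g' -> Gr k I Q' ->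
  g * g' = 1 -> Q * Q' = 1 -> inK (g * Q * (g' * Q')).
Proof.
move=> [GQ eQ pQ] Gg Gg' GQ' gg' QQ'; have GM := GrM char0.
have eQ' : ev Q' = 1%g by have := evM GQ GQ'; rewrite QQ' ev1 eQ mul1g.
have pQ' : erase z Q' = 1 by have := eraseM z Q Q'; rewrite QQ' erase1 pQ mul1r.
split; first by apply: (GM) => //; apply: GM.
  rewrite !evM //; try exact: GM.
  by rewrite eQ eQ' !mulg1 -evM // gg' ev1.
by rewrite !eraseM pQ pQ' !mulr1 -eraseM gg' erase1.
Qed.

(* [P] is the leading term, in degree [n], of an element of the kernel. *)
Definition lead n P :=
  exists Q, [/\ inK Q, ord n (Q - 1) & ord n.+1 (Q - 1 - P)].

Lemma lead0 n : lead n 0.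
Proof.
by exists 1; split; [apply: inK1|rewrite subrr|rewrite subrr subrr].
Qed.

Lemma inK_ord1 Q : inK Q -> ord 1 (Q - 1).
Proof. by case=> GQ _ _; apply: Gr_ord1. Qed.

Lemma leadD n P R : lead n P -> lead n R -> lead n (P + R).
Proof.
move=> [Q [KQ oQ oQP]] [S [KS oS oSR]].
have QSE : Q * S - 1 = (Q - 1) * (S - 1) + ((Q - 1) + (S - 1)).
  by rewrite mulrBl mul1r mulrBr mulr1 [Q - 1 + _]addrC subrKA subrKA.
exists (Q * S); split; first exact: inKM.
  by rewrite QSE; apply: ordD; [apply: ordMr|apply: ordD].
rewrite QSE -addrA; apply: ordD.
  by apply: (@ordM _ _ 1) oS; apply: inK_ord1.
by rewrite opprD addrACA; apply: ordD.
Qed.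

Lemma leadZ n (a : k) P : lead n P -> lead n (a *: P).
Proof.
move=> [Q [KQ oQ oQP]]; exists (series_pow Q a).
have o1 : ord 1 (1 - 1 : series k I) by rewrite subrr.
have := pow_sub a o1 (inK_ord1 KQ) oQ.
have -> : series_pow 1 a = 1 :> series k I.
  by rewrite /series_pow log1 scaler0 exp0.
move=> oQa; split; first exact: inK_pow.
  by apply: ord_congr (ord_le (leqnSn n) oQa) _; apply: ordZ.
by apply: ord_trans oQa _; rewrite -scalerBr; apply: ordZ.
Qed.

Lemma leadN n P : lead n P -> lead n (- P).
Proof. by rewrite -scaleN1r; apply: leadZ. Qed.

Lemma lead_sum n (J : Type) (r : seq J) (F : J -> series k I) :
  (forall j, lead n (F j)) -> lead n (\sum_(j <- r) F j).
Proof.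
by move=> lF; apply: big_ind => //; [apply: lead0|apply: leadD].
Qed.

(** A group commutator of [exp M] with a kernel element lies in the kernel and has the Lie bracket
    as leading term. *)
Lemma lead_br m n M P : Lie k I M -> ord m M -> lead n P ->
  lead (m + n) (lie_br M P).
Proof.
move=> LM oM [Q [KQ oQ oQP]]; have [GQ _ _] := KQ.
have GM := Gr_exp LM; have o1M := Lie_ord1 LM.
have [M' [GM' MM' M'M]] := Gr_inv char0 GM.
have [Q' [GQ' QQ' Q'Q]] := Gr_inv char0 GQ.
exists (series_exp M * Q * (M' * Q')).
pose X := lie_br (series_exp M - 1) (Q - 1).
have CE : series_exp M * Q * (M' * Q') - 1 = X * (M' * Q').
  rewrite /X lie_br1 /lie_br mulrBl; congr (_ - _).
  by rewrite mulrA -(mulrA Q) MM' mulr1.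
have oM1 : ord m.+1 (series_exp M - 1 - M).
  by have := @exp_sub k I 0 M m (@ord_0 k I 1) o1M; rewrite exp0 subr0; apply.
have oMm : ord m (series_exp M - 1) by apply: ord_congr oM; apply: ord_le oM1.
have oX : ord (m + n) X by apply: lie_br_ord.
rewrite CE; split; first exact: inK_comm.
  exact: ordMr.
have -> : X * (M' * Q') - lie_br M P = X * (M' * Q' - 1) + (X - lie_br M P).
  by rewrite mulrBr mulr1 subrKA.
apply: ordD.
  by rewrite -addn1; apply: ordM => //; apply/Gr_ord1/GrM.
apply: (@ord_trans _ _ _ _ (lie_br M (Q - 1))).
  by rewrite -lie_brBl -addSn; apply: lie_br_ord.
by rewrite -lie_brBr -addnS; apply: lie_br_ord.
Qed.

(** Finiteness of the alphabet enters here: there are finitely many words of length [n], hence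
    finitely many terms that are nonzero on one of them. *)
Lemma hpart_series_sum n (J : Type) (P : J -> series k I) :
  summable setT P -> exists s : seq J,
    hpart n (series_sum setT P) = \sum_(j <- s) hpart n (P j).
Proof.
move=> sP.
have /finite_seqP[s sE] : finite_set
    (\bigcup_(w in [set: n.-tuple I]) [set j : {classic J} | P j w <> 0]).
  apply: bigcup_finite => // w _; apply: sub_finite_set (sP w) => j /= Pj.
  by split.
exists (undup s : seq {classic J}); apply/funext => w; rewrite sumE /hpart /filt.
case: eqP => [wn|_]; last by rewrite big1.
rewrite /series_sum (@fsum_seq _ _ _ (undup s)) ?undup_uniq // => j _ js.
apply: contrapT => Pj; move/negP: js; apply.
suff : [set` s] j by rewrite /= -mem_undup.
by rewrite -sE; move/eqP: wn => wn; exists (Tuple wn).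
Qed.

Hypothesis lead_z : lead 1 (series_var z).

Lemma eraseB P Q : erase z (P - Q) = erase z P - erase z Q.
Proof. exact: filtB. Qed.

Lemma hpart_erase n P : hpart n (erase z P) = erase z (hpart n P).
Proof. by apply/funext => w; rewrite /hpart /erase /filt; do 2?case: ifP. Qed.

(** [P - erase z P] lies in the closed Lie ideal generated by the variable [z]. Leading terms are
    stable under linear combinations and brackets with Lie series, so [lead_z] suffices. *)
Lemma lead_Lie P n : Lie k I P -> lead n (hpart n (P - erase z P)).
Proof.
pose S P := Lie k I P /\ forall n, lead n (hpart n (P - erase z P)).
move=> LP; suff [] : S P by [].
move: P LP {n}; apply: (@Lie_ind _ _ S); last first.
  move=> i; split=> [|n]; first exact: Lie_var.
  rewrite /erase filt_var mem_seq1; case: eqVneq => [<-|_] /=.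
    rewrite subr0 /hpart filt_var /=.
    by case: eqP => [<-|_]; [apply: lead_z|apply: lead0].
  by rewrite subrr /hpart filt0; apply: lead0.
split.
- split=> [|n]; first exact: Lie_0.
  by rewrite /erase filt0 subrr /hpart filt0; apply: lead0.
- move=> a P Q [LP lP] [LQ lQ]; split=> [|n]; first exact: Lie_lin.
  rewrite /erase filtD filtZ opprD addrACA -scalerBr /hpart filtD filtZ.
  by apply: leadD; [apply/leadZ/lP|apply: lQ].
- move=> P Q [LP lP] [LQ lQ]; split=> [|n]; first exact: Lie_br.
  (* In each bracket on the right one entry is a difference covered by the induction hypothesis. *)
  have -> : lie_br P Q - erase z (lie_br P Q) =
      lie_br P (Q - erase z Q) - lie_br (erase z Q) (P - erase z P).
    rewrite !lie_brBr [lie_br (erase z Q) P]lie_br_anti.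
    rewrite -opprD opprK addrA subrK.
    by congr (_ + _); rewrite /lie_br eraseB !eraseM opprB.
  rewrite [hpart _ _]filtB -!/(hpart _ _) !hpart_br.
  apply: leadD; last apply: leadN; apply: lead_sum => a.
    rewrite -{1}(subnKC (leq_ord a)); apply: lead_br (lQ _).
      exact: Lie_hpart.
    exact: hpart_ord.
  rewrite -{1}(subnKC (leq_ord a)); apply: lead_br (lP _).
    by apply: Lie_hpart; apply: Lie_erase.
  exact: hpart_ord.
move=> J P sP lP; split=> [|n].
  by case: (lie_closed_Lie k I) => _ _ _; apply=> // j; case: (lP j).
rewrite [hpart _ _]filtB -!/(hpart _ _) hpart_erase.
have [s ->] := hpart_series_sum n sP; rewrite /erase filt_sum -sumrB.
apply: lead_sum => j; rewrite -/(erase _ _) -hpart_erase.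
by rewrite /hpart -filtB; case: (lP j).
Qed.

(** The leading term of [B - 1] is that of its logarithm, a Lie series killed by [erase z], hence
    that of some kernel element [Q]. Division by [Q] brings [B] one degree closer to 1. *)
Lemma lead_Gr B n : Gr k I B -> erase z B = 1 -> ord n.+1 (B - 1) ->
  exists Q C, [/\ inK Q, ord n.+1 (Q - 1) & [/\ Gr k I C, erase z C = 1,
    ord n.+2 (C - 1) & B = C * Q]].
Proof.
move=> GB pB oB; have o1B := Gr_ord1 GB.
have o1 : ord 1 (1 - 1 : series k I) by rewrite subrr.
have oR : ord n.+2 (series_log B - (B - 1)).
  by have := log_sub o1 o1B oB; rewrite log1 subr0.
have oRn : ord n.+1 (series_log B) by apply: ord_congr oB; apply: ord_le oR.
have := lead_Lie n.+1 (Gr_log char0 GB).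
rewrite erase_log // pB log1 subr0 => -[Q [KQ oQ oQR]].
have [GQ eQ pQ] := KQ; have [Q' [GQ' QQ' Q'Q]] := Gr_inv char0 GQ.
have pQ' : erase z Q' = 1 by have := eraseM z Q Q'; rewrite QQ' erase1 pQ mul1r.
exists Q, (B * Q'); split=> //; split.
- exact: GrM.
- by rewrite eraseM pB pQ' mulr1.
- rewrite -QQ' -mulrBl; apply: ordMr.
  have -> : B - Q = (B - 1) - (Q - 1) by rewrite opprB addrA subrK.
  apply: ord_trans (ord_sym oR) _.
  apply: ord_trans (ord_sym oQR).
  exact: sub_hpart.
by rewrite -mulrA Q'Q mulr1.
Qed.

Lemma ev_kernel B : Gr k I B -> erase z B = 1 -> ev B = 1%g.
Proof.
move=> GB pB.
pose good n C := [/\ Gr k I C, erase z C = 1 & ord n.+1 (C - 1)].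
(* One choice for all degrees and remainders prepares the recursion; [(0, 0)] is a default for
   inputs that are not [good]. *)
have /choice[f fP] (x : nat * series k I) : exists y : series k I * series k I,
    good x.1 x.2 -> [/\ inK y.1, ord x.1.+1 (y.1 - 1), good x.1.+1 y.2 &
      x.2 = y.2 * y.1].
  have [[GC pC oC]|nC] := pselect (good x.1 x.2); last by exists (0, 0) => /nC.
  by have [Q [C [KQ oQ [GC' pC' oC' E]]]] := lead_Gr GC pC oC; exists (Q, C).
have [C C0 CS] : exists2 C : nat -> series k I, C 0%N = B &
    forall n, C n.+1 = (f (n, C n)).2.
  pose C := fix C n := if n is m.+1 then (f (m, C m)).2 else B.
  by exists C.
have gC n : good n (C n).
  elim: n => [|n IH]; first by rewrite C0; split=> //; apply: Gr_ord1.
  by rewrite CS; have [] := fP (n, C n) IH.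
pose Q n := (f (n, C n)).1.
have QP n : [/\ inK (Q n), ord n.+1 (Q n - 1) & C n = C n.+1 * Q n].
  by rewrite CS; have [] := fP (n, C n) (gC n).
have <- : series_prod gtn_order Q = B.
  rewrite -C0; apply: series_prod_lim => n; try by case: (QP n).
  by case: (gC n).
have [] := @ev_mult nat gtn_order Q.
- by move=> n; case: (QP n) => -[].
- apply: summable_ord => n; apply: (ord_le (leqnSn n)); by case: (QP n).
(* All factors evaluate to 1, and [gprod_fin] with empty support gives the empty product. *)
move=> _ <-; have -> : ev \o Q = fun=> 1%g.
  by apply/funext => n /=; case: (QP n) => -[].
rewrite (@gprod_fin _ G _ _ _ 0 (fun=> 0%N)) ?big_ord0 //; first by case.
by apply/seteqP; split=> [j|j [[]]].
Qed.

End Kernel.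

(** * Evaluations at finite families *)

Section FiniteFamilies.
Variable T : finType.

(** Any linear order on the finite set would serve: [has_evaluations] needs one to express
    multipliability. *)
Definition rank_lt : rel T := fun x y => (enum_rank x < enum_rank y)%N.

Fact rank_irr : irreflexive rank_lt. Proof. by move=> x; apply: ltnn. Qed.

Fact rank_trans : transitive rank_lt.
Proof. by move=> y x z; apply: ltn_trans. Qed.

Fact rank_total x y : x <> y -> rank_lt x y || rank_lt y x.
Proof.
move=> xy; rewrite /rank_lt -neq_ltn; apply/eqP => /val_inj/enum_rank_inj.
exact: xy.
Qed.

Definition rank_order : linear_order T :=
  LinearOrder rank_irr rank_trans rank_total.

Lemma finite_evaluation (k : fieldType) (G : multExpGroupType k) (f : T -> G) :
  has_evaluations G -> exists ev : series k T -> G,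
    [/\ gr_morphism ev, gr_strongly_multiplicative ev &
        forall i, ev (series_exp (series_var i)) = f i].
Proof.
move=> evG; apply: (evG _ rank_order); apply: multipliable_fin.
exact: finite_finset.
Qed.

End FiniteFamilies.

(** * The equation under an evaluation *)

Section Evaluation.
Variables (k : fieldType) (I : finType) (G : multExpGroupType k).
Hypothesis char0 : [pchar k] =i pred0.
Variable ev : series k I -> G.
Hypothesis ev_hom : gr_morphism ev.
Variables (n : nat) (l : 'I_n -> k) (A : 'I_n -> series k I).
Hypothesis A_Gr : forall i, Gr k I (A i).
Implicit Types F : series k I.

Lemma ev_lhs F : Gr k I F ->
  ev (lhs l A F) = (\prod_(i < n) (ev (A i) * ev F ^^ l i))%g.
Proof.
(* Membership in [Gr] is carried along, since [ev] is known to be multiplicative only there. *)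
move=> GF; suff [] : Gr k I (lhs l A F) /\
  ev (lhs l A F) = (\prod_(i < n) (ev (A i) * ev F ^^ l i))%g by [].
apply: (big_ind2 (fun P x => Gr k I P /\ ev P = x)) =>
  [|P x Q y [GP <-] [GQ <-]|i _].
- by split; [apply: Gr1|apply: (ev1 ev_hom)].
- by split; [apply: GrM|rewrite (evM ev_hom)].
have GFi := Gr_pow char0 (l i) GF; split; first exact: GrM.
by rewrite (evM ev_hom) // (ev_pow ev_hom).
Qed.

Lemma erase_lhs z F : (forall i, erase z (A i) = A i) -> Gr k I F ->
  erase z (lhs l A F) = lhs l A (erase z F).
Proof.
move=> Az GF; rewrite /lhs (big_morph _ (@eraseM k I z) (@erase1 k I z)).
by apply: eq_bigr => i _; rewrite eraseM Az erase_pow.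
Qed.

Hypothesis suml_neq0 : \sum_i l i != 0.

(** The heart of uniqueness: [ev F] and [ev (F * Z)] are two solutions, and the quotient [r] of
    their equations provides the hypothesis [lead_z] of [ev_kernel]. *)
Lemma ev_var_eq1 z F : gr_strongly_multiplicative ev ->
  (forall i, erase z (A i) = A i) -> Gr k I F -> erase z F = F ->
  ev (lhs l A F) = 1%g ->
  ev (lhs l A (F * series_exp (series_var z))) = 1%g ->
  ev (series_exp (series_var z)) = 1%g.
Proof.
move=> ev_mult Az GF Fz evF; set Z := series_exp _ => evFZ.
have LX := @Lie_var k I z; have oX := Lie_ord1 LX.
have GZ : Gr k I Z := Gr_exp LX.
have Xz : erase z (series_var z) = 0 :> series k I.
  by rewrite /erase filt_var mem_seq1 eqxx.
have Zz : erase z Z = 1 by rewrite /Z erase_exp // Xz exp0.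
have GFZ := GrM char0 GF GZ.
have GlF := Gr_lhs char0 l A_Gr GF; have GlFZ := Gr_lhs char0 l A_Gr GFZ.
have [V [GV FV VF]] := Gr_inv char0 GlF.
have Vz : erase z V = V.
  have: erase z (V * lhs l A F) = 1 by rewrite VF erase1.
  rewrite eraseM erase_lhs // Fz => Vl.
  by rewrite -[LHS]mulr1 -FV mulrA Vl mul1r.
pose r := V * lhs l A (F * Z).
have Kr : inK z ev r.
  split; first exact: GrM.
    rewrite (evM ev_hom) // evFZ mulg1.
    by have := evM ev_hom GlF GV; rewrite FV (ev1 ev_hom) evF mul1g.
  by rewrite /r eraseM Vz erase_lhs // eraseM Fz Zz mulr1.
have oF := Gr_ord1 GF; have oZ := Gr_ord1 GZ.
have oZX : ord 2 (Z - 1 - series_var z).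
  have := @exp_sub k I 0 _ 1 (@ord_0 k I 1) oX; rewrite exp0 subr0.
  by apply.
have FZF : F * Z - F = F * (Z - 1) by rewrite mulrBr mulr1.
have oFZF : ord 1 (F * Z - F) by rewrite FZF; apply: ordMl.
have lFZ := lhs_sub l A_Gr oF (Gr_ord1 GFZ) oFZF.
have olFZ : ord 1 (lhs l A (F * Z) - lhs l A F).
  by apply: ord_congr (ord_le (leqnSn 1) lFZ) _; apply: ordZ.
have rE : r - 1 = V * (lhs l A (F * Z) - lhs l A F) by rewrite mulrBr VF.
(* Modulo order 2 the factors [V] and [F] act as 1 on the difference, and [lhs_sub] supplies the
   slope. *)
have or : ord 2 (r - 1 - (\sum_i l i) *: series_var z).
  rewrite rE; apply: (@ord_trans _ _ _ _ (lhs l A (F * Z) - lhs l A F)).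
    rewrite -{2}(mul1r (_ - lhs l A F)) -mulrBl.
    by apply: (@ordM _ _ 1 1) => //; apply: Gr_ord1.
  apply: ord_trans lFZ _; rewrite -scalerBr; apply: ordZ; rewrite FZF.
  apply: ord_trans oZX; rewrite -{2}(mul1r (Z - 1)) -mulrBl.
  exact: (@ordM _ _ 1 1).
have ledz : lead z ev 1 (series_var z).
  rewrite -[series_var z]scale1r -(mulVf suml_neq0) -scalerA.
  apply: leadZ => //.
  by exists r; split=> //; rewrite rE; apply: ordMl.
exact: (ev_kernel char0 ev_hom ev_mult ledz).
Qed.

End Evaluation.

(** * Existence and uniqueness of the solution *)

Theorem theorem5 (k : fieldType) (char0 : [pchar k] =i pred0)
    (G : multExpGroupType k) (evG : has_evaluations G)
    (n : nat) (n_gt0 : (0 < n)%N) (g : 'I_n -> G) (l : 'I_n -> k)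
    (suml_neq0 : \sum_(i < n) l i != 0) :
  exists! f : G, (\prod_(i < n) (g i * f ^^ l i) = 1)%g.
Proof.
have [f fP] : exists f : G, (\prod_(i < n) (g i * f ^^ l i) = 1)%g.
  have [ev [ev_hom _ evX]] := finite_evaluation g evG.
  pose A (i : 'I_n) : series k 'I_n := series_exp (series_var i).
  have AG i : Gr k 'I_n (A i) by apply: Gr_exp; apply: Lie_var.
  have [F GF F1] := lhs_solution char0 AG suml_neq0.
  exists (ev F); have := ev_lhs char0 ev_hom l AG GF.
  by rewrite F1 (ev1 ev_hom); under eq_bigr do rewrite evX.
exists f; split=> // f' f'P.
(* Beside the letters for the [g i], [Some None] carries [f], and [None], the letter to be erased,
   carries the quotient of the two solutions, which has to be 1. *)
pose fam (i : option (option 'I_n)) : G :=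
  match i with
  | Some (Some i) => g i | Some None => f | None => (f^-1 * f')%g
  end.
have [ev [ev_hom ev_mult evX]] := finite_evaluation fam evG.
pose X i : series k (option (option 'I_n)) := series_exp (series_var i).
have XG i : Gr k _ (X i) by apply: Gr_exp; apply: Lie_var.
have XN i : erase None (X (Some i)) = X (Some i).
  rewrite /X erase_exp; last by apply: Lie_ord1; apply: Lie_var.
  by rewrite /erase filt_var mem_seq1.
have evXN : ev (X None) = 1%g.
  apply: (@ev_var_eq1 k _ G char0 ev ev_hom n l (fun i => X (Some (Some i))) _
    suml_neq0 None (X (Some None))) => //.
    rewrite (ev_lhs char0 ev_hom) // evX -[RHS]fP.
    by apply: eq_bigr => i _; rewrite evX.
  rewrite (ev_lhs char0 ev_hom) //; last exact: (GrM char0 (XG _) (XG _)).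
  rewrite (evM ev_hom (XG _) (XG None)) (evX (Some None)) (evX None) /= mulVKg.
  rewrite -[RHS]f'P.
  by apply: eq_bigr => i _; rewrite evX.
by rewrite -[LHS]mulg1 -evXN evX /= mulVKg.
Qed.
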